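(* Let $\alpha\in(0,1)$, $E>0$, $\eta>0$, and put $\tau=\eta/E$. The creep function associated with the fractional initial value problem $$\eta^{\alpha}\left({}^{C}D_{0}^{\alpha}\epsilon\right)(t)+E^{\alpha}\epsilon(t)=\sigma(t),\quad 0<t\leq 1,\qquad \epsilon(0)=0,$$ is given by $$k_{\alpha}(t)=-\left(\frac{\tau}{\eta}\right)^{\alpha}\left(E_{\alpha}\left(-\left(\frac{t}{\tau}\right)^{\alpha}\right)-1\right),\quad 0\le t\le 1.$$
   Context: ${}^{C}D_{0}^{\alpha}$ denotes the Caputo fractional derivative of order $\alpha\in(0,1)$ with base point $0$: $\left({}^{C}D_{0}^{\alpha}\epsilon\right)(t)=\frac{1}{\Gamma(1-\alpha)}\frac{d}{dt}\int_0^t (t-s)^{-\alpha}\left(\epsilon(s)-\epsilon(0)\right)ds$ (which equals $\frac{1}{\Gamma(1-\alpha)}\int_0^t (t-s)^{-\alpha}\epsilon'(s)\,ds$ when $\epsilon$ is absolutely continuous). The stress $\sigma:[0,1]\to\mathbb{R}$ is a continuous function, and the corresponding strain is the solution $\epsilon\in C[0,1]$ of the initial value problem, namely $$\epsilon(t)=\frac{1}{\eta^{\alpha}}\int_{0}^{t}(t-s)^{\alpha-1}E_{\alpha,\alpha}\left(-\left(\frac{t-s}{\tau}\right)^{\alpha}\right)\sigma(s)\,ds,\quad 0\le t\le 1.$$ The Mittag-Leffler functions are $E_{\alpha}(z)=\sum_{n=0}^{\infty}\frac{z^{n}}{\Gamma(\alpha n+1)}$ and $E_{\alpha,\beta}(z)=\sum_{n=0}^{\infty}\frac{z^{n}}{\Gamma(\alpha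 n+\beta)}$ for $\alpha,\beta>0$, $z\in\mathbb{C}$, with $\Gamma$ the Gamma function; the constant $E$ (no subscript) is a positive real number unrelated to these functions. The creep function associated with the problem is the continuous function $k_{\alpha}:[0,1]\to\mathbb{R}$ such that, for every stress $\sigma$, the corresponding strain is $$\epsilon(t)=\int_{0}^{t}k_{\alpha}(t-s)\,d\sigma(s),\quad 0\leq t\leq 1.$$ Here the integral is a Stieltjes integral in which the material is at rest (zero stress and strain) before time $0$, so that the jump of $\sigma$ from $0$ to $\sigma(0)$ at time $0$ is included; that is, $\int_{0}^{t}k_{\alpha}(t-s)\,d\sigma(s)$ means $k_{\alpha}(t)\sigma(0)$ plus the Riemann-Stieltjes integral of $k_{\alpha}(t-s)$ against $\sigma$ over $[0,t]$ (which is $\int_0^t k_{\alpha}(t-s)\sigma'(s)\,ds$ when $\sigma$ is continuously differentiable). *)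

(* Defs.v *)
From mathcomp Require Import all_boot all_order all_algebra.
From mathcomp Require Import all_classical all_reals all_analysis.

Set Implicit Arguments.
Unset Strict Implicit.
Unset Printing Implicit Defensive.

Import Order.TTheory GRing.Theory Num.Theory.
Import numFieldNormedType.Exports.

Local Open Scope classical_set_scope.
Local Open Scope ring_scope.

(* Euler's integral; equal to the Gamma function only for x > 0, the only
   arguments at which it is used. *)
Definition Gamma (R : realType) (x : R) : R :=
  \int[@lebesgue_measure R]_(t in `]0, +oo[) (t `^ (x - 1) * expR (- t)).

(* E_a(z) = \sum_n z^n / Gamma(a n + 1), at real arguments z. *)
Definition mittag_leffler (R : realType) (a z : R) : R :=
  limn (series (fun n : nat => z ^+ n / Gamma (a * n%:R + 1))).

(* Two-sided at interior points of an interval D, one-sided at its endpoints. *)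
Definition has_derivative_within (R : realType) (D : set R) (f : R -> R)
    (t d : R) : Prop :=
  (fun s => (f s - f t) / (s - t)) @ within D t^' --> d.

(* The Caputo derivative, of order a and base point 0, of a function on [0, 1]
   exists at t and equals d.  Only the values of eps on [0, 1] matter. The value
   0 `^ (- a) = 0 of the kernel at s = u is irrelevant, being taken on a null
   set. *)
Definition is_caputo_derivative (R : realType) (a : R) (eps : R -> R)
    (t d : R) : Prop :=
  exists2 d' : R,
    has_derivative_within `[0, 1]
      (fun u => \int[@lebesgue_measure R]_(s in `[0, u])
                  ((u - s) `^ (- a) * (eps s - eps 0))) t d'
    & d = (Gamma (1 - a))^-1 * d'.

(* eps, restricted to [0, 1], is a continuous solution of
   eta^alpha (D^alpha eps)(t) + E^alpha eps(t) = sigma(t) for 0 < t <= 1,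
   eps(0) = 0. *)
Definition is_strain (R : realType) (alpha E eta : R) (sigma eps : R -> R)
    : Prop :=
  [/\ {within `[0, 1], continuous eps},
      eps 0 = 0
    & forall t : R, 0 < t <= 1 ->
        exists2 d : R, is_caputo_derivative alpha eps t d
          & eta `^ alpha * d + E `^ alpha * eps t = sigma t].

(* The tagged partition a = x_0 <= ... <= x_n = b with tags
   xi_i \in [x_i, x_(i+1)]; the values of x beyond n and of xi from n on are
   irrelevant. *)
Definition tagged_partition (R : realType) (a b : R) (n : nat) (x xi : nat -> R)
    : Prop :=
  [/\ x 0%N = a, x n = b
    & forall i : nat, (i < n)%N -> x i <= xi i <= x i.+1].

(* The Riemann-Stieltjes integral of f against g over [a, b], as a limit of
   sums when the mesh tends to 0, exists and equals l.  No bounded variation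
   is required of g. *)
Definition is_riemann_stieltjes (R : realType) (f g : R -> R) (a b l : R)
    : Prop :=
  forall e : R, 0 < e -> exists2 delta : R, 0 < delta &
    forall (n : nat) (x xi : nat -> R),
      tagged_partition a b n x xi ->
      (forall i : nat, (i < n)%N -> x i.+1 - x i < delta) ->
      `| \sum_(i < n) f (xi i) * (g (x i.+1) - g (x i)) - l | < e.

(* The integral of k(t - s) d sigma(s) over [0, t] exists and equals v, where
   sigma vanishes before time 0: its jump from 0 to sigma(0) contributes
   k(t) sigma(0). *)
Definition is_creep_integral (R : realType) (k sigma : R -> R) (t v : R)
    : Prop :=
  exists2 l : R, is_riemann_stieltjes (fun s => k (t - s)) sigma 0 t l
    & v = k t * sigma 0 + l.

(* k and sigma are functions on [0, 1], extended arbitrarily to R.  Together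
   the two conclusions say that every stress sigma determines exactly one strain
   on [0, 1] and that it is the creep integral of sigma. *)
Definition is_creep_function (R : realType) (alpha E eta : R) (k : R -> R)
    : Prop :=
  {within `[0, 1], continuous k} /\
  forall sigma : R -> R, {within `[0, 1], continuous sigma} ->
    (exists eps : R -> R, is_strain alpha E eta sigma eps) /\
    (forall eps : R -> R, is_strain alpha E eta sigma eps ->
       forall t : R, 0 <= t <= 1 -> is_creep_integral k sigma t (eps t)).

(* Main.v *)
Require Import Defs.
From mathcomp Require Import all_boot all_order all_algebra.
From mathcomp Require Import all_classical all_reals all_analysis.
From mathcomp Require Import measurable_realfun.
From mathcomp Require Import ring.

Import Order.TTheory GRing.Theory Num.Theory.
Import numFieldNormedType.Exports.

Local Open Scope classical_set_scope.
Local Open Scope ring_scope.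

Set Implicit Arguments.
Unset Strict Implicit.
Unset Printing Implicit Defensive.

(** Write phi_a(t) = t^(a-1) / Gamma(a) for t > 0 and phi_a(t) = 0 otherwise,
and let I^a f(t) be the integral of phi_a(t - s) f(s) over [0, t], the
Riemann-Liouville integral of order a of a continuous function f.

The analytic fact behind everything is the semigroup law I^a I^b = I^(a+b),
that is, the convolution of phi_a and phi_b is phi_(a+b) [conv_rl_kernel].
By homogeneity this convolution is a multiple of phi_(a+b), and integrating
both sides against exp(-t) shows that the multiple is 1.

Let lam = (E / eta)^alpha.  The Caputo derivative of a function eps with
eps(0) = 0 is the derivative of I^(1-alpha) eps, so the equation says that
I^(1-alpha) eps has derivative g = eta^(-alpha) sigma - lam eps, hence
I^(1-alpha) eps = I^1 g.  Applying I^alpha gives I^1 eps = I^1 I^alpha g, and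
differentiating gives the Volterra equation eps = I^alpha g; each step can be
reversed [strain_volterra, volterra_strain].  Substituting the Volterra
equation into itself forces
  eps = eta^(-alpha) sum_n (-lam)^n I^(alpha (n+1)) sigma.
Because Gamma(a n + 1) grows faster than any geometric sequence, the series
converges uniformly on [0, 1] and the remainder of the iteration vanishes, so
every stress determines exactly one strain [volterra_exists,
volterra_neumann].

The function phi_(b+1) is a nondecreasing primitive of phi_b vanishing at 0.
Summation by parts therefore bounds the difference between a Riemann-Stieltjes
sum of phi_(b+1)(t - s) against sigma, together with the initial jump, and
I^b sigma(t) by phi_(b+1)(t) times the oscillation of sigma over the partition
[rs_sum_rl_kernel].  Summing this bound over the series gives that the strain
is the creep integral of sigma for
  k = eta^(-alpha) sum_n (-lam)^n phi_(alpha (n+1) + 1),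
which is the strain under the unit stress and, up to a shift of the index, the
Mittag-Leffler series of the statement.  Conversely the unit stress does not
vary after time 0, so its creep integral is k(t): a creep function can only be
the strain under the unit stress. *)

(** * Convolution of nonnegative functions on the line *)

Section convolution.
Context {R : realType}.
Local Open Scope ereal_scope.
Notation mu := (@lebesgue_measure R).
Implicit Types (f g h : R -> \bar R) (c d t : R).

Let measurable_affine c d :
  measurable_fun [set: R] (fun x : R => (c * x + d)%R : measurableTypeR R).
Proof. by apply: measurable_funD => //; exact: measurable_funM. Qed.

(** Lebesgue measure and the rescaled image measure agree on intervals. *)
Lemma ge0_integral_affine f c d : (0 < c)%R -> measurable_fun setT f ->
  (forall x, 0 <= f x) -> \int[mu]_x f x = c%:E * \int[mu]_x f (c * x + d)%R.
Proof.
move=> c0 mf f0; pose k : {nonneg R} := NngNum (ltW c0).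
pose phi (x : measurableTypeR R) : measurableTypeR R := (c * x + d)%R.
have mphi : measurable_fun setT phi := measurable_affine c d.
pose nu : {measure set (measurableTypeR R) -> \bar R} :=
  measure_function_pushforward__canonical__measure_function_Measure mu mphi.
have munu A : measurable A -> mu A = mscale k nu A.
  move=> mA; apply: lebesgue_measure_unique => //= _ [[a b]] _ <-.
  have pre : phi @^-1` `]a, b] = `](a - d) / c, (b - d) / c]%classic%R.
    apply/seteqP; split=> x /=; rewrite !in_itv/= ltr_pdivrMr// ler_pdivlMr//;
    by rewrite ltrBlDr lerBrDr [(x * c)%R]mulrC.
  change (mu `]a, b] = c%:E * mu (phi @^-1` `]a, b])); rewrite pre.
  rewrite !lebesgue_measure_itv/= !lte_fin ltr_pM2r ?invr_gt0// ltrD2r.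
  case: ifPn => _; last by rewrite mule0.
  by rewrite -!EFinB -EFinM -mulrBl opprB addrA subrK mulrC divfK ?gt_eqF.
transitivity (\int[mscale k nu]_x f x).
  by apply: eq_measure_integral => //= A mA _; exact: munu.
rewrite ge0_integral_mscale//; congr (_ * _).
by rewrite ge0_integral_pushforward// preimage_setT.
Qed.

Lemma ge0_integral_shift f d : measurable_fun setT f -> (forall x, 0 <= f x) ->
  \int[mu]_x f x = \int[mu]_x f (x + d)%R.
Proof.
move=> mf f0; rewrite (@ge0_integral_affine _ 1 d)// mul1e.
by apply: eq_integral => x _; rewrite mul1r.
Qed.

Lemma ge0_integral_opp f : measurable_fun setT f -> (forall x, 0 <= f x) ->
  \int[mu]_x f x = \int[mu]_x f (- x)%R.
Proof.
move=> mf f0; transitivity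
  (\int[pushforward mu (-%R : measurableTypeR R -> measurableTypeR R)]_x f x).
  by apply: eq_measure_integral => //= A mA _; exact/esym/lebesgue_measureN.
by rewrite ge0_integral_pushforward// preimage_setT.
Qed.

Definition conv f g t := \int[mu]_x (f (t - x)%R * g x).

Lemma conv_ge0 f g t : (forall x, 0 <= f x) -> (forall x, 0 <= g x) ->
  0 <= conv f g t.
Proof. by move=> f0 g0; apply: integral_ge0 => x _; exact: mule_ge0. Qed.

Let measurable_conv2 f g : measurable_fun setT f -> measurable_fun setT g ->
  measurable_fun setT
    (fun z : measurableTypeR R * measurableTypeR R => f (z.1 - z.2)%R * g z.2).
Proof.
move=> mf mg; apply: emeasurable_funM; last exact: measurableT_comp.
by apply: measurableT_comp => //; exact: measurable_funB.
Qed.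

(** Tonelli, after translating the variable of the outer convolution. *)
Lemma convA f g h :
  measurable_fun setT f -> measurable_fun setT g -> measurable_fun setT h ->
  (forall x, 0 <= f x) -> (forall x, 0 <= g x) -> (forall x, 0 <= h x) ->
  conv f (conv g h) = conv (conv f g) h.
Proof.
move=> mf mg mh f0 g0 h0; apply/funext => t.
have msub (u : R -> \bar R) (s : R) : measurable_fun setT u ->
    measurable_fun setT (fun x : R => u (s - x)%R).
  by move=> mu_; apply: measurableT_comp => //; exact: measurable_funB.
have mgh y : measurable_fun setT (fun x : R => g (y - x)%R * h x).
  by apply: emeasurable_funM => //; exact: msub.
rewrite /conv.
transitivity (\int[mu]_y \int[mu]_x (f (t - y)%R * (g (y - x)%R * h x))).
  apply: eq_integral => y _; rewrite ge0_integralZl//.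
    exact: mgh.
  by move=> x _; exact: mule_ge0.
rewrite (fubini_tonelli (m1 := mu) (m2 := mu)
  (fun z : measurableTypeR R * measurableTypeR R =>
    f (t - z.1)%R * (g (z.1 - z.2)%R * h z.2)))/=; last 2 first.
- apply: emeasurable_funM; last exact: measurable_conv2.
  by apply: measurableT_comp => //; exact: measurable_funB.
- by move=> z; rewrite mule_ge0// mule_ge0.
apply: eq_integral => x _.
rewrite (@ge0_integral_shift _ x); last 2 first.
- apply: emeasurable_funM; first exact: msub.
  apply: emeasurable_funM => //.
  by apply: measurableT_comp => //; exact: measurable_funB.
- by move=> y; rewrite mule_ge0// mule_ge0.
rewrite -ge0_integralZr//; last 2 first.
- by apply: emeasurable_funM => //; exact: msub.
- by move=> y _; exact: mule_ge0.
apply: eq_integral => y _; rewrite addrK muleA; congr (f _ * _ * _).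
by rewrite opprD addrCA addrC.
Qed.

Lemma integral_conv f g : measurable_fun setT f -> measurable_fun setT g ->
  (forall x, 0 <= f x) -> (forall x, 0 <= g x) ->
  \int[mu]_t conv f g t = \int[mu]_x f x * \int[mu]_x g x.
Proof.
move=> mf mg f0 g0; rewrite /conv.
rewrite (fubini_tonelli (m1 := mu) (m2 := mu)
  (fun z : measurableTypeR R * measurableTypeR R =>
    f (z.1 - z.2)%R * g z.2))/=; last 2 first.
- exact: measurable_conv2.
- by move=> z; exact: mule_ge0.
have If0 : 0 <= \int[mu]_x f x by exact: integral_ge0.
rewrite -ge0_integralZl//.
apply: eq_integral => x _; rewrite ge0_integralZr//; last first.
  by apply: measurableT_comp => //; exact: measurable_funB.
by rewrite -(ge0_integral_shift (- x)%R mf).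
Qed.

End convolution.

(** * The kernels t^(a-1) and the Gamma integral *)
Section power_kernel.
Context {R : realType}.
Notation mu := (@lebesgue_measure R).
Implicit Types (a b t x : R).

Definition power_kernel a t : R := if 0 < t then t `^ (a - 1) else 0.

Lemma power_kernel_ge0 a t : 0 <= power_kernel a t.
Proof. by rewrite /power_kernel; case: ifP => // _; exact: powR_ge0. Qed.

Lemma measurable_power_kernel a : measurable_fun setT (power_kernel a).
Proof.
apply: measurable_fun_ifT; last exact: measurable_cst.
  exact: measurable_fun_ltr.
exact: measurable_powR.
Qed.

Lemma power_kernelZ a t x : 0 < t ->
  power_kernel a (t * x) = t `^ (a - 1) * power_kernel a x.
Proof.
move=> t0; rewrite /power_kernel pmulr_rgt0//; case: ifPn => [x0|_].
  by rewrite powRM// ltW.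
by rewrite mulr0.
Qed.

Local Open Scope ereal_scope.

(** The Beta integral, the convolution of two kernels at time 1.  It is kept
extended real because its finiteness is deduced from that of the Gamma
integrals. *)
Definition euler_beta a b : \bar R :=
  conv (EFin \o power_kernel a) (EFin \o power_kernel b) 1%R.

(** Homogeneity: substitute s = t u in the convolution at time t. *)
Lemma conv_power_kernel a b t :
  conv (EFin \o power_kernel a) (EFin \o power_kernel b) t =
  euler_beta a b * (power_kernel (a + b) t)%:E.
Proof.
have [t0|t0] := leP t 0%R.
  rewrite [in RHS]/power_kernel ltNge t0/= mule0 /conv.
  apply: integral0_eq => x _ /=; rewrite -EFinM /power_kernel subr_gt0.
  case: ifPn => xt; last by rewrite mul0r.
  by rewrite ltNge (le_trans (ltW xt) t0)/= mulr0.
have mk c : measurable_fun setT (EFin \o power_kernel c).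
  by apply/measurable_EFinP; exact: measurable_power_kernel.
have m1 s : measurable_fun setT (fun x : R =>
    (EFin \o power_kernel a) (s - x)%R * (EFin \o power_kernel b) x).
  apply: emeasurable_funM => //.
  by apply: measurableT_comp => //; exact: measurable_funB.
have k0 s x : 0 <= (EFin \o power_kernel a) (s - x)%R *
    (EFin \o power_kernel b) x.
  by rewrite mule_ge0//= lee_fin power_kernel_ge0.
rewrite /conv (ge0_integral_affine 0%R t0 (m1 t))//.
under eq_integral.
  move=> x _ /=; rewrite addr0 -[X in (X - _)%R]mulr1 -mulrBr !power_kernelZ//.
  rewrite !EFinM muleACA; over.
rewrite ge0_integralZl//; last 3 first.
- exact: (m1 1%R).
- by move=> x _; exact: k0.
- by rewrite mule_ge0// lee_fin powR_ge0.
rewrite muleA [RHS]muleC; congr (_ * _).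
rewrite /power_kernel t0 -!EFinM; congr EFin.
rewrite -{1}(powRr1 (ltW t0)) -!powRD ?(gt_eqF t0) ?implybT//.
by congr powR; ring.
Qed.

(** The Gamma integral before taking its real part, for use where its
finiteness is not yet known. *)
Definition gamma_integral a : \bar R :=
  \int[mu]_t (power_kernel a t * expR (- t))%:E.

Let cexp : continuous (fun x : R => expR (- x)).
Proof.
move=> x; apply: continuous_comp; first exact: opp_continuous.
exact: continuous_expR.
Qed.

Let mexp : measurable_fun setT (fun x : R => expR (- x)).
Proof. exact: continuous_measurable_fun. Qed.

Let gk a t := (power_kernel a t * expR (- t))%R.

Let mgk a : measurable_fun setT (gk a).
Proof. by apply: measurable_funM => //; exact: measurable_power_kernel. Qed.

Let gk_ge0 a t : (0 <= gk a t)%R.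
Proof. by rewrite mulr_ge0 ?power_kernel_ge0 ?expR_ge0. Qed.

Lemma gamma_integralE a :
  gamma_integral a =
  \int[mu]_(t in `]0%R, +oo[) (t `^ (a - 1) * expR (- t))%:E.
Proof.
rewrite [RHS]integral_mkcond; apply: eq_integral => t _.
rewrite patchE /power_kernel; case: ifPn => t0.
  by rewrite mem_set//= in_itv/= t0.
by rewrite memNset ?mul0r//= in_itv/= andbT; exact/negP.
Qed.

(** The integral of a convolution is the product of the integrals, and the
factor exp(-t) distributes over a convolution since exp(-(t-x)) exp(-x) =
exp(-t). *)
Lemma gamma_integral_conv a b :
  gamma_integral a * gamma_integral b =
  euler_beta a b * gamma_integral (a + b).
Proof.
have mE c : measurable_fun setT (EFin \o gk c) by exact/measurable_EFinP.
have E0 c x : 0 <= (EFin \o gk c) x by rewrite lee_fin.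
rewrite /gamma_integral -(integral_conv (mE a) (mE b))//.
rewrite -ge0_integralZl//; last 3 first.
- exact: (mE (a + b)%R).
- by move=> x _; exact: (E0 (a + b)%R).
- by apply: conv_ge0 => x; rewrite lee_fin power_kernel_ge0.
apply: eq_integral => t _; rewrite EFinM muleA -conv_power_kernel /conv.
rewrite -ge0_integralZr//; last 2 first.
- apply: emeasurable_funM.
    apply: measurableT_comp.
      by apply/measurable_EFinP; exact: measurable_power_kernel.
    exact: measurable_funB.
  by apply/measurable_EFinP; exact: measurable_power_kernel.
- by move=> x _; rewrite mule_ge0//= lee_fin power_kernel_ge0.
apply: eq_integral => x _; rewrite /= -!EFinM; congr EFin.
by rewrite /gk mulrACA -expRD; congr (_ * expR _)%R; ring.
Qed.

Let derive_expN (x : R) :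
  is_derive x 1%R (fun x : R => - expR (- x))%R (expR (- x)).
Proof.
rewrite -[X in is_derive _ _ _ X]opprK; apply: is_deriveN.
rewrite -[X in is_derive _ _ _ X]mulrN1.
apply: (@is_derive1_comp _ expR -%R); exact: is_deriveNid.
Qed.

Lemma integral_expN_itvcy (A : R) :
  \int[mu]_(t in `[A, +oo[) (expR (- t))%:E = (expR (- A))%:E.
Proof.
rewrite (@ge0_continuous_FTC2y _ _ (fun x => - expR (- x))%R _ 0%R)//.
- by rewrite EFinN oppeK add0e.
- exact: continuous_subspaceT.
- by rewrite -oppr0; apply: cvgN; exact: cvgr_expR.
- by apply: cvgN; apply/cvg_at_right_filter; exact: cexp.
- by move=> x _; rewrite derive1E; have [_ ->] := derive_expN x.
Qed.

End power_kernel.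

Section gamma.
Context {R : realType}.
Notation mu := (@lebesgue_measure R).
Implicit Types (a b t x : R).
Local Open Scope ereal_scope.

Let measurable_gk a :
  measurable_fun setT (fun t : R => power_kernel a t * expR (- t))%R.
Proof.
apply: measurable_funM; first exact: measurable_power_kernel.
by apply: measurableT_comp; [exact: measurable_expR|exact: measurable_funN].
Qed.

Let gk_ge0 a t : (0 <= power_kernel a t * expR (- t))%R.
Proof. by rewrite mulr_ge0 ?power_kernel_ge0 ?expR_ge0. Qed.

Lemma gamma_integral1 : gamma_integral (1 : R) = 1.
Proof.
rewrite gamma_integralE.
transitivity (\int[mu]_(t in `]0%R, +oo[) (expR (- t))%:E).
  by apply: eq_integral => t _; rewrite subrr powRr0 mul1r.
rewrite integral_itv_obnd_cbnd; last first.
  apply/measurable_EFinP; apply: measurable_funTS.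
  by apply: measurableT_comp; [exact: measurable_expR|exact: measurable_funN].
by rewrite integral_expN_itvcy oppr0 expR0.
Qed.

(** Keep only the part of the integral over [A, +oo[, where t^x >= A^x.  As A
is arbitrary, Gamma beats every geometric sequence. *)
Lemma gamma_integral_lb (A x : R) : (0 < A)%R -> (0 <= x)%R ->
  (A `^ x * expR (- A))%:E <= gamma_integral (x + 1).
Proof.
move=> A0 x0; rewrite EFinM -integral_expN_itvcy.
rewrite -ge0_integralZl//; last 2 first.
- apply/measurable_EFinP; apply: measurable_funTS.
  by apply: measurableT_comp; [exact: measurable_expR|exact: measurable_funN].
- by rewrite lee_fin powR_ge0.
have mgE D : measurable D -> measurable_fun D (fun t : R =>
    (power_kernel (x + 1) t * expR (- t))%:E).
  by move=> mD; apply/measurable_EFinP/measurable_funTS; exact: measurable_gk.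
apply: (@le_trans _ _ (\int[mu]_(t in `[A, +oo[)
    (power_kernel (x + 1) t * expR (- t))%:E)).
  apply: ge0_le_integral => //.

  - by move=> t _; rewrite mule_ge0// lee_fin ?powR_ge0 ?expR_ge0.
  - apply/measurable_EFinP; apply: measurable_funM => //.
    apply: measurable_funTS.
    by apply: measurableT_comp; [exact: measurable_expR|exact: measurable_funN].
  - exact: mgE.
  - move=> t /=; rewrite in_itv/= andbT => At; rewrite -EFinM lee_fin.
    rewrite ler_wpM2r ?expR_ge0// /power_kernel (lt_le_trans A0 At) addrK.
    by rewrite ge0_ler_powR// nnegrE ltW// (lt_le_trans A0 At).
apply: ge0_subset_integral => //; first exact: mgE.
by move=> t _; rewrite lee_fin.
Qed.

Lemma gamma_integral_gt0 a : (0 < a)%R -> 0 < gamma_integral a.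
Proof.
move=> a0; have [a1|a1] := leP 1%R a.
  have := @gamma_integral_lb 1 (a - 1) ltr01.
  rewrite subr_ge0 subrK => /(_ a1); apply: lt_le_trans.
  by rewrite lte_fin powR1 mul1r expR_gt0.
apply: (@lt_le_trans _ _ (\int[mu]_(t in `]0%R, 1%R]) (expR (- 1))%:E)).
  rewrite integral_cst//= lebesgue_measure_itv/= lte_fin ltr01.
  by rewrite oppr0 adde0 mule1 lte_fin expR_gt0.
apply: (@le_trans _ _ (\int[mu]_(t in `]0%R, 1%R])
    (power_kernel a t * expR (- t))%:E)).
  apply: ge0_le_integral => //.
  - by apply/measurable_EFinP/measurable_funTS; exact: measurable_gk.
  - move=> t /=; rewrite in_itv/= => /andP[t0 t1]; rewrite lee_fin.
    rewrite -[leLHS]mul1r ler_pM// ?ler_expR ?expR_ge0//; last by rewrite lerN2.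
    rewrite /power_kernel t0 -[leLHS](powRr0 t) ger_powR ?t0//.
    by rewrite subr_le0 ltW.
apply: ge0_subset_integral => //.
  by apply/measurable_EFinP; exact: measurable_gk.
by move=> t _; rewrite lee_fin.
Qed.

Lemma integral_powR_01 a : (0 < a)%R ->
  \int[mu]_(t in `]0%R, 1%R]) (t `^ (a - 1))%:E <= (a^-1)%:E.
Proof.
move=> a0; pose F n : set R := `[(n.+2%:R^-1)%R, 1%R]%classic.
have -> : `]0%R, 1%R]%classic = \bigcup_n F n.
  apply/seteqP; split=> [t|t [n _]] /=; rewrite /F/= !in_itv/=.
    move=> /andP[t0 t1]; exists (Num.truncn t^-1) => //.
    rewrite /F/= in_itv/= t1 andbT.
    rewrite invf_ple ?posrE//; apply: ltW.
    apply: lt_trans (truncnS_gt _) _.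
    by rewrite ltr_nat.
  by move=> /andP[nt ->]; rewrite andbT (lt_le_trans _ nt).
have mp D : measurable_fun D (fun t : R => (t `^ (a - 1))%:E).
  by apply/measurable_EFinP/measurable_funTS; exact: measurable_powR.
have /cvg_lim <- // : \int[mu]_(x in F i) (x `^ (a - 1))%:E @[i --> \oo] -->
    \int[mu]_(x in \bigcup_i F i) (x `^ (a - 1))%:E.
  apply: ge0_nondecreasing_set_cvg_integral => //.
  - apply/nondecreasing_seqP => n; apply/subsetPset => t /=.
    rewrite /F/= !in_itv/= => /andP[nt ->]; rewrite andbT (le_trans _ nt)//.
    by rewrite lef_pV2 ?posrE// ler_nat.
  - by move=> n; exact: measurable_itv.
  - by move=> n; exact: mp.
  - by move=> n x _; rewrite lee_fin powR_ge0.
apply: lime_le.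
  apply: ereal_nondecreasing_is_cvgn.
  apply: ge0_nondecreasing_set_nondecreasing_integral => //.
  - apply/nondecreasing_seqP => n; apply/subsetPset => t /=.
    rewrite /F/= !in_itv/= => /andP[nt ->]; rewrite andbT (le_trans _ nt)//.
    by rewrite lef_pV2 ?posrE// ler_nat.
  - by move=> n; exact: measurable_itv.
  - by move=> n; exact: mp.
  - by move=> n x _; rewrite lee_fin powR_ge0.
apply: nearW => n; set c : R := (n.+2%:R^-1)%R.
have c0 : (0 < c)%R by rewrite invr_gt0.
have c1 : (c < 1)%R by rewrite invf_lt1// ltr1n.
have dF x : (0 < x)%R ->
    is_derive x 1%R (fun x : R => a^-1 * x `^ a)%R (x `^ (a - 1))%R.
  move=> x0; rewrite -[X in is_derive _ _ _ X](mulKf (lt0r_neq0 a0)).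
  by apply: is_deriveZ; exact: is_derive1_powR.
have cF (y : R) : (0 < y)%R ->
    {for y, continuous (fun x : R => a^-1 * x `^ a)%R}.
  move=> y0; apply/differentiable_continuous/derivable1_diffP.
  by have [] := dF _ y0.
rewrite (@continuous_FTC2 _ _ (fun x : R => a^-1 * x `^ a)%R)//.
- rewrite powR1 mulr1 -EFinB lee_fin lerBlDr lerDl.
  by rewrite mulr_ge0 ?powR_ge0 ?invr_ge0 ?ltW.
- apply: continuous_in_subspaceT => y; rewrite inE/= in_itv/= => /andP[cy _].
  apply/differentiable_continuous/derivable1_diffP.
  by apply: derivable_powR; rewrite in_itv/= (lt_le_trans c0 cy).
- split.
  + move=> x; rewrite in_itv/= => /andP[cx _].
    by have [] := dF _ (lt_trans c0 cx).
  + by apply/cvg_at_right_filter; exact: cF.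
  + by apply/cvg_at_left_filter; exact: cF.
- move=> x; rewrite in_itv/= => /andP[cx _].
  by rewrite derive1E; have [_ ->] := dF _ (lt_trans c0 cx).
Qed.

Lemma gamma_integral_lty_le1 a : (0 < a <= 1)%R -> gamma_integral a < +oo.
Proof.
move=> /andP[a0 a1].
have me D : measurable_fun D (fun t : R => (expR (- t))%:E).
  apply/measurable_EFinP/measurable_funTS.
  by apply: measurableT_comp; [exact: measurable_expR|exact: measurable_funN].
have mp D : measurable_fun D (fun t : R => (t `^ (a - 1))%:E).
  by apply/measurable_EFinP/measurable_funTS; exact: measurable_powR.
have mg D : measurable_fun D (fun t : R => (t `^ (a - 1) * expR (- t))%:E).
  by apply/measurable_EFinP/measurable_funM; apply/measurable_EFinP.
rewrite gamma_integralE.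
rewrite (_ : `]0%R, +oo[%classic = `]0%R, 1%R] `|` `]1%R, +oo[); last first.
  apply/seteqP; split=> t /=; rewrite !in_itv/= !andbT.
    by move=> ->; case: leP => _; [left|right].
  by move=> [/andP[]//|]; exact: lt_trans.
rewrite ge0_integral_setU//=; last 3 first.
- exact: mg.
- by move=> t _; rewrite lee_fin mulr_ge0 ?powR_ge0 ?expR_ge0.
- rewrite disj_set2E; apply/eqP; rewrite -subset0 => t /=.
  rewrite !in_itv/= andbT.
  by move=> [/andP[_ +]]; rewrite leNgt => /negP.
apply: lte_add_pinfty.
  apply: (@le_lt_trans _ _ (a^-1)%:E); last by rewrite ltry.
  apply: le_trans (integral_powR_01 a0).
  apply: ge0_le_integral => //.
  - by move=> t _; rewrite lee_fin mulr_ge0 ?powR_ge0 ?expR_ge0.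
  - exact: mg.
  - exact: mp.
  - move=> t /=; rewrite in_itv/= => /andP[t0 _]; rewrite lee_fin.
    by rewrite ler_piMr ?powR_ge0// -expR0 ler_expR oppr_le0 ltW.
apply: (@le_lt_trans _ _ (\int[mu]_(t in `[1%R, +oo[) (expR (- t))%:E));
  last by rewrite integral_expN_itvcy ltry.
rewrite -integral_itv_obnd_cbnd; last exact: me.
apply: ge0_le_integral => //.
- by move=> t _; rewrite lee_fin mulr_ge0 ?powR_ge0 ?expR_ge0.
- exact: mg.
- exact: me.
- move=> t /=; rewrite in_itv/= andbT => t1; rewrite lee_fin.
  rewrite ler_piMl ?expR_ge0// -[leRHS](powRr0 t) ler_powR ?(ltW t1)//.
  by rewrite subr_le0.
Qed.

(** In gamma_integral_conv the Beta factor cannot be 0, since the left-hand side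
is positive, so an infinite value at a + b would make the product infinite.
This reduces finiteness to arguments at most 1, with no comparison between
powers and the exponential. *)
Lemma gamma_integral_addlty a b : (0 < a)%R -> (0 < b)%R ->
  gamma_integral a < +oo -> gamma_integral b < +oo ->
  gamma_integral (a + b) < +oo.
Proof.
move=> a0 b0; have : 0 <= euler_beta a b.
  by apply: conv_ge0 => x; rewrite lee_fin power_kernel_ge0.
have := gamma_integral_gt0 (addr_gt0 a0 b0).
move: (gamma_integral_gt0 a0) (gamma_integral_gt0 b0) (gamma_integral_conv a b).
move: (gamma_integral a) (gamma_integral b) (gamma_integral (a + b))%R.
move: (euler_beta a b) => B A1 A2 A3 A1p A2p prodE A3p B0 A1oo A2oo.
have pfin : A1 * A2 < +oo by rewrite lte_mul_pinfty ?ge0_fin_numE// ltW.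
have pgt0 : 0 < A1 * A2 by rewrite mule_gt0.
have := leey A3; rewrite le_eqVlt => /predU1P[A3oo|//].
move: B0; rewrite le_eqVlt => /predU1P[B0|B0].
  by move: pgt0; rewrite prodE -B0 mul0e ltxx.
by move: pfin; rewrite prodE A3oo gt0_muley// ltxx.
Qed.

Lemma gamma_integral_lty a : (0 < a)%R -> gamma_integral a < +oo.
Proof.
move=> a0; have [n] : exists n, (a <= n.+1%:R)%R.
  by exists (Num.truncn a); apply: ltW; exact: truncnS_gt.
elim: n a a0 => [|n IH] a a0 an.
  by apply: gamma_integral_lty_le1; rewrite a0.
have [an1|an1] := leP a n.+1%:R; first exact: IH.
have a1 : (1 < a)%R by rewrite (le_lt_trans _ an1)// ler1n.
rewrite -(subrK 1%R a); apply: gamma_integral_addlty => //.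
- by rewrite subr_gt0.
- apply: IH; first by rewrite subr_gt0.
  by rewrite lerBlDr -natr1 in an *.
- by rewrite gamma_integral1 ltry.
Qed.

Lemma Gamma_integral a : (0 < a)%R -> gamma_integral a = (Gamma a)%:E.
Proof.
move=> a0; rewrite /Gamma /Rintegral -gamma_integralE fineK//.
by rewrite ge0_fin_numE ?gamma_integral_lty// ltW// gamma_integral_gt0.
Qed.

Lemma Gamma_gt0 a : (0 < a)%R -> (0 < Gamma a)%R.
Proof. by move=> a0; rewrite -lte_fin -Gamma_integral// gamma_integral_gt0. Qed.

Lemma Gamma1 : Gamma (1 : R) = 1%R.
Proof. by apply: EFin_inj; rewrite -Gamma_integral// gamma_integral1. Qed.

Lemma Gamma_lb (A x : R) : (0 < A)%R -> (0 <= x)%R ->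
  (A `^ x * expR (- A) <= Gamma (x + 1))%R.
Proof.
move=> A0 x0; rewrite -lee_fin -Gamma_integral ?gamma_integral_lb//.
exact: ltr_wpDl.
Qed.

Definition rl_kernel a t : R := power_kernel a t / Gamma a.

Lemma rl_kernel_ge0 a t : (0 < a)%R -> (0 <= rl_kernel a t)%R.
Proof.
by move=> a0; rewrite divr_ge0 ?power_kernel_ge0// ltW// Gamma_gt0.
Qed.

Lemma measurable_rl_kernel a : measurable_fun setT (rl_kernel a).
Proof. by apply: measurable_funM => //; exact: measurable_power_kernel. Qed.

(** The identity B(a, b) Gamma(a + b) = Gamma(a) Gamma(b) says exactly that the
normalized kernels form a convolution semigroup. *)
Lemma conv_rl_kernel a b : (0 < a)%R -> (0 < b)%R ->
  conv (EFin \o rl_kernel a) (EFin \o rl_kernel b) = EFin \o rl_kernel (a + b).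
Proof.
move=> a0 b0; apply/funext => t; rewrite /conv /rl_kernel/=.
have ab0 := addr_gt0 a0 b0.
transitivity (((Gamma a)^-1 * (Gamma b)^-1)%:E *
    conv (EFin \o power_kernel a) (EFin \o power_kernel b) t).
  rewrite /conv -ge0_integralZl//; last 3 first.
  - apply: emeasurable_funM.
      apply: measurableT_comp.
        by apply/measurable_EFinP; exact: measurable_power_kernel.
      exact: measurable_funB.
    by apply/measurable_EFinP; exact: measurable_power_kernel.
  - by move=> x _; rewrite mule_ge0//= lee_fin power_kernel_ge0.
  - by rewrite lee_fin mulr_ge0// invr_ge0 ltW// Gamma_gt0.
  apply: eq_integral => x _ /=; rewrite -!EFinM; congr EFin.
  by rewrite mulrACA mulrC.
rewrite conv_power_kernel.
have : 0 <= euler_beta a b.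
  by apply: conv_ge0 => x; rewrite lee_fin power_kernel_ge0.
have := gamma_integral_conv a b.
rewrite (Gamma_integral a0) (Gamma_integral b0) (Gamma_integral ab0).
have := Gamma_gt0 ab0; move: (Gamma_gt0 a0) (Gamma_gt0 b0).
move: (Gamma a) (Gamma b) (Gamma (a + b)) (power_kernel (a + b) t).
move: (euler_beta a b) => [B||] ga gb gab p ga0 gb0 gab0 //=.
  by move=> [E] _; congr EFin; rewrite -[B](mulfK (lt0r_neq0 gab0)) -E; field;
    rewrite !gt_eqF.
by rewrite gt0_mulye.
Qed.

End gamma.

(** * The Riemann-Liouville integral *)
Section riemann_liouville.
Context {R : realType}.
Notation mu := (@lebesgue_measure R).
Implicit Types (a b t x : R) (f g : R -> R).

Lemma continuous_maxr (c : R) : continuous (fun x : R => Num.max x c).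
Proof.
move=> x.
rewrite (_ : (fun x => _) = (fun x => (x + c + `|x - c|) / 2)); last first.
  by apply/funext => y; rewrite maxr_absE.
apply: cvgMl; apply: cvgD; first by apply: cvgD; [exact: cvg_id|exact: cvg_cst].
by apply: cvg_norm; apply: cvgB; [exact: cvg_id|exact: cvg_cst].
Qed.

Lemma continuous_bounded_itv f (a b : R) : continuous f ->
  exists2 M : R, 0 <= M & forall s, a <= s <= b -> `|f s| <= M.
Proof.
move=> cf; have [ab|ba] := leP a b; last first.
  exists 0 => // s /andP[as_ sb].
  by have := le_lt_trans (le_trans as_ sb) ba; rewrite ltxx.
have cnf : {within `[a, b], continuous (fun s => `|f s|)}.
  by apply: continuous_subspaceT => x; apply: cvg_norm; exact: cf.
have [c _ hc] := EVT_max ab cnf.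
by exists `|f c| => // s sab; apply: hc; rewrite in_itv.
Qed.

Lemma rl_kernel1 t : rl_kernel 1 t = (0 < t)%R%:R.
Proof.
by rewrite /rl_kernel /power_kernel Gamma1 subrr powRr0 invr1 mulr1; case: ifP.
Qed.

Lemma rl_kernelS a t : 0 < t -> rl_kernel (a + 1) t = t `^ a / Gamma (a + 1).
Proof. by move=> t0; rewrite /rl_kernel /power_kernel t0 addrK. Qed.

Lemma rl_kernel_le0 a t : t <= 0 -> rl_kernel a t = 0.
Proof. by move=> t0; rewrite /rl_kernel /power_kernel ltNge t0/= mul0r. Qed.

Lemma continuous_rl_kernelS a : 0 < a -> continuous (rl_kernel (a + 1)).
Proof.
move=> a0 t.
have cl : {for t, continuous (fun x : R => (Num.max x 0) `^ a)}.
  have [t0|t0] := leP t 0.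
    have E0 : (Num.max t 0) `^ a = 0 by rewrite max_r// powR0// gt_eqF.
    rewrite /prop_for /continuous_at E0.
    apply/cvgrPdist_lt => e e0.
    have /cvgrPdist_lt/(_ _ e0) := powR_cvg0 a0.
    move=> [d /= d0 hd]; exists d => //= x /=; rewrite sub0r normrN => tx.
    have [x0|x0] := leP x 0; first by rewrite powR0 ?gt_eqF// normr0.
    have xd : `|0 - x| < d.
      rewrite sub0r normrN gtr0_norm//; apply: le_lt_trans tx.
      by rewrite distrC (le_trans _ (ler_norm _))// lerBrDr gerDl.
    by have := hd x xd x0; rewrite sub0r normrN.
  apply: (@continuous_comp _ _ _ (fun x => Num.max x 0) (fun y => y `^ a)).
    exact: continuous_maxr.
  rewrite /= max_l; last exact: ltW.
  apply/differentiable_continuous/derivable1_diffP.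
  by apply: derivable_powR; rewrite in_itv/= t0.
rewrite (_ : rl_kernel (a + 1) =
    (fun x => (Num.max x 0) `^ a / Gamma (a + 1))); last first.
  apply/funext => x; have [x0|x0] := leP x 0.
    by rewrite rl_kernel_le0// powR0 ?mul0r ?gt_eqF.
  by rewrite rl_kernelS.
by apply: cvgMl; exact: cl.
Qed.

Lemma rl_kernelS_homo a : 0 < a -> {homo rl_kernel (a + 1) : x y / x <= y}.
Proof.
move=> a0 x y xy; have a10 : 0 < a + 1 by exact: addr_gt0.
have [x0|x0] := leP x 0; first by rewrite (rl_kernel_le0 _ x0) rl_kernel_ge0.
have y0 := lt_le_trans x0 xy; rewrite (rl_kernelS _ x0) (rl_kernelS _ y0).
rewrite ler_pM2r ?invr_gt0 ?Gamma_gt0//.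
by apply: ge0_ler_powR; rewrite ?nnegrE// ltW.
Qed.

(** Extension by zero to the past turns integrals over ]0, t] into convolutions
on the line, because rl_kernel a vanishes on negative arguments. *)
Definition causal f s : R := if 0 < s then f s else 0.

Lemma measurable_causal f :
  measurable_fun setT f -> measurable_fun setT (causal f).
Proof.
move=> mf; apply: measurable_fun_ifT => //.
exact: measurable_fun_ltr.
Qed.

Lemma rl_patch a f t (s : R) :
  rl_kernel a (t - s) * causal f s =
  ((fun s : R => rl_kernel a (t - s) * f s) \_ `]0, t]) s.
Proof.
rewrite patchE /causal; case: ifPn => s0; last first.
  by rewrite mulr0 memNset//= in_itv/= (negbTE s0).
case: ifPn => // /negP; rewrite inE/= in_itv/= s0/= => /negP.
rewrite -ltNge => ts.
by rewrite rl_kernel_le0 ?mul0r// subr_le0 ltW.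
Qed.

Lemma measurable_rl_integrand a f t : measurable_fun setT f ->
  measurable_fun setT (fun s : R => rl_kernel a (t - s) * f s).
Proof.
move=> mf; apply: measurable_funM => //.
apply: measurableT_comp; first exact: measurable_rl_kernel.
exact: measurable_funB.
Qed.

(** For t > 0 the kernel of order 1 is the constant 1, so integrating over
]0, t] is convolving with it. *)
Lemma integral_rl_kernel a t : 0 < a ->
  (\int[mu]_(s in `]0%R, t]) (rl_kernel a (t - s))%:E =
   (rl_kernel (a + 1) t)%:E)%E.
Proof.
move=> a0; rewrite integral_mkcond.
rewrite -[RHS]/((EFin \o rl_kernel (a + 1)) t) -(conv_rl_kernel a0 (@ltr01 R)).
apply: eq_integral => s _; rewrite /= -EFinM rl_kernel1 restrict_EFin.
congr EFin.
have -> : (0 < s)%R%:R = causal (cst 1) s by rewrite /causal; case: ifP.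
by rewrite rl_patch !patchE mulr1.
Qed.

Lemma integrable_rl a f t : 0 < a -> continuous f ->
  mu.-integrable `]0, t] (EFin \o (fun s : R => rl_kernel a (t - s) * f s)).
Proof.
move=> a0 cf.
have mf : measurable_fun setT f := continuous_measurable_fun cf.
have ik : mu.-integrable `]0, t] (fun s => (rl_kernel a (t - s))%:E).
  apply/integrableP; split.
    apply/measurable_EFinP; apply: measurable_funTS.
    apply: measurableT_comp; first exact: measurable_rl_kernel.
    exact: measurable_funB.
  under eq_integral do rewrite gee0_abs ?lee_fin ?rl_kernel_ge0//.
  by rewrite integral_rl_kernel// ltry.
have -> : EFin \o (fun s : R => rl_kernel a (t - s) * f s) =
    ((fun s : R => (rl_kernel a (t - s))%:E) \* (EFin \o f))%E by [].
apply: integrableMl => //.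
  exact: measurable_funTS.
have [M M0 hM] := continuous_bounded_itv 0 t cf.
exists M; split; first exact: num_real.
move=> N MN s; rewrite /= in_itv/= => /andP[s0 st].
by rewrite (le_trans _ (ltW MN))// hM// (ltW s0).
Qed.

Definition rl_integral a f t : R :=
  \int[mu]_(s in `]0, t]) (rl_kernel a (t - s) * f s).

Lemma rl_integral_eq a f g t : (forall s, 0 < s <= t -> f s = g s) ->
  rl_integral a f t = rl_integral a g t.
Proof.
move=> fg; apply: eq_Rintegral => s; rewrite inE/= in_itv/= => st.
by rewrite fg.
Qed.

Lemma rl_integral_le0 a f t : t <= 0 -> rl_integral a f t = 0.
Proof.
move=> t0; rewrite /rl_integral set_itv_ge ?Rintegral_set0//.
by rewrite bnd_simp -leNgt.
Qed.

Lemma rl_integralD a f g t : 0 < a -> continuous f -> continuous g ->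
  rl_integral a (fun s => f s + g s) t = rl_integral a f t + rl_integral a g t.
Proof.
move=> a0 cf cg; rewrite /rl_integral -RintegralD//; last 2 first.
- exact: integrable_rl.
- exact: integrable_rl.
by apply: eq_Rintegral => s _; rewrite mulrDr.
Qed.

Lemma rl_integralZ a c f t : 0 < a -> continuous f ->
  rl_integral a (fun s => c * f s) t = c * rl_integral a f t.
Proof.
move=> a0 cf; rewrite /rl_integral -RintegralZl//; last exact: integrable_rl.
by apply: eq_Rintegral => s _; rewrite mulrCA.
Qed.

Lemma rl_integralB a f g t : 0 < a -> continuous f -> continuous g ->
  rl_integral a (fun s => f s - g s) t = rl_integral a f t - rl_integral a g t.
Proof.
move=> a0 cf cg; rewrite rl_integralD//; last first.
  by move=> x; apply: cvgN; exact: cg.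
congr (_ + _); rewrite -mulN1r -rl_integralZ//.
by apply: rl_integral_eq => s _; rewrite mulN1r.
Qed.

Lemma rl_integral_cst a c t : 0 < a ->
  rl_integral a (fun=> c) t = c * rl_kernel (a + 1) t.
Proof.
move=> a0; have -> : (fun=> c) = (fun s : R => c * (fun=> 1) s).
  by apply/funext => s; rewrite mulr1.
rewrite rl_integralZ//; last by move=> x; exact: cvg_cst.
congr (_ * _); rewrite /rl_integral /Rintegral.
under eq_integral do rewrite mulr1.
by rewrite integral_rl_kernel.
Qed.

Lemma rl_integral_le a f g t : 0 < a -> continuous f -> continuous g ->
  (forall s, 0 < s <= t -> f s <= g s) ->
  rl_integral a f t <= rl_integral a g t.
Proof.
move=> a0 cf cg fg; apply: le_Rintegral => //.
- exact: integrable_rl.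
- exact: integrable_rl.
- move=> s /=; rewrite in_itv/= => st.
  by rewrite ler_wpM2l ?rl_kernel_ge0// fg.
Qed.

Lemma rl_integral_bound a f t M : 0 < a -> continuous f ->
  (forall s, 0 < s <= t -> `|f s| <= M) ->
  `|rl_integral a f t| <= M * rl_kernel (a + 1) t.
Proof.
move=> a0 cf fM; rewrite ler_norml -mulNr -!rl_integral_cst//.
have cc c : continuous (fun _ : R => c : R) by move=> x; exact: cvg_cst.
by rewrite !rl_integral_le// => s /fM; rewrite ler_norml => /andP[].
Qed.

Lemma EFin_rl_integral a f t : 0 < a -> continuous f ->
  (rl_integral a f t)%:E = conv (EFin \o rl_kernel a) (EFin \o causal f) t.
Proof.
move=> a0 cf; rewrite /rl_integral /Rintegral fineK; last first.
  by apply: integrable_fin_num => //; exact: integrable_rl.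
rewrite integral_mkcond /conv; apply: eq_integral => s _.
by rewrite /= -EFinM rl_patch restrict_EFin.
Qed.

Lemma integral_reflect (f : R -> \bar R) t : measurable_fun setT f ->
  (\int[mu]_x f x = \int[mu]_x f (t - x)%R)%E.
Proof.
have ge0 (g : R -> \bar R) : measurable_fun setT g -> (forall x, 0 <= g x)%E ->
    (\int[mu]_x g x = \int[mu]_x g (t - x)%R)%E.
  move=> mg g0; rewrite (ge0_integral_shift t mg g0) ge0_integral_opp//.
    by apply: eq_integral => x _; rewrite addrC.
  by apply: measurableT_comp => //; exact: measurable_funD.
move=> mf; rewrite integralE [in RHS]integralE.
congr (_ - _)%E.
  rewrite (ge0 f^\+%E)//; last exact: measurable_funepos.
  by apply: eq_integral => x _; rewrite !funeposE.
rewrite (ge0 f^\-%E)//; last exact: measurable_funeneg.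
by apply: eq_integral => x _; rewrite !funenegE.
Qed.

End riemann_liouville.

Section riemann_liouville_theory.
Context {R : realType}.
Notation mu := (@lebesgue_measure R).
Implicit Types (a b t x : R) (f g : R -> R).

(** After the reflection s = t - u neither the singular factor of the integrand
nor the domain depends on t; dominated convergence then applies. *)
Lemma rl_integral_reflect a f t T : 0 < a -> continuous f -> t <= T ->
  rl_integral a f t =
  \int[mu]_(u in `]0, T]) (rl_kernel a u * causal f (t - u)).
Proof.
move=> a0 cf tT; rewrite /Rintegral.
have mf : measurable_fun setT f := continuous_measurable_fun cf.
rewrite -[LHS]/(fine (rl_integral a f t)%:E) EFin_rl_integral//; congr fine.
rewrite /conv (@integral_reflect _ _ t); last first.
  apply/measurable_EFinP; apply: measurable_rl_integrand.
  exact: measurable_causal.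
rewrite [RHS]integral_mkcond; apply: eq_integral => u _.
rewrite /= -EFinM subKr patchE; case: ifPn => //.
move=> /negP; rewrite inE/= in_itv/= => /negP; rewrite negb_and -leNgt -ltNge.
move=> /orP[u0|Tu]; first by rewrite rl_kernel_le0// mul0r.
by rewrite /causal subr_gt0 ltNge (le_trans tT (ltW Tu))/= mulr0.
Qed.

(** On ]0, T[ the kernel is dominated by the integrand of the convolution of
orders 1 and a at time T. *)
Lemma integrable_rl_kernel a T : 0 < a ->
  mu.-integrable `]0, T] (EFin \o rl_kernel a).
Proof.
move=> a0; have [T0|T0] := leP T 0.
  by rewrite set_itv_ge ?bnd_simp -?leNgt//; exact: integrable_set0.
apply/integrableP; split.
  by apply/measurable_EFinP/measurable_funTS; exact: measurable_rl_kernel.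
under eq_integral do rewrite gee0_abs ?lee_fin ?rl_kernel_ge0//.
rewrite -integral_itv_bndo_bndc; last first.
  by apply/measurable_EFinP/measurable_funTS; exact: measurable_rl_kernel.
apply: (@le_lt_trans _ _ (conv (EFin \o rl_kernel 1) (EFin \o rl_kernel a) T)).
  rewrite integral_mkcond /conv; apply: ge0_le_integral => //.
  - move=> s _; rewrite patchE; case: ifP => // _.
    by rewrite lee_fin rl_kernel_ge0.
  - apply/(measurable_restrictT _ _).1 => //.
    by apply/measurable_EFinP/measurable_funTS; exact: measurable_rl_kernel.
  - apply: emeasurable_funM.
      apply/measurable_EFinP.
      apply: measurableT_comp; first exact: measurable_rl_kernel.
      exact: measurable_funB.
    by apply/measurable_EFinP; exact: measurable_rl_kernel.
  - move=> s _; rewrite patchE; case: ifPn => [|_].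
      rewrite inE/= in_itv/= => /andP[s0 sT].
      by rewrite rl_kernel1 subr_gt0 sT mul1e.
    by rewrite mule_ge0// lee_fin rl_kernel_ge0.
by rewrite conv_rl_kernel//= ltry.
Qed.

(** The extension by zero of f jumps at 0 by f 0.  Subtracting this constant,
whose integral is an explicit kernel, leaves a function whose extension is
continuous, and dominated convergence applies to that one. *)
Lemma continuous_rl_integral a f : 0 < a -> continuous f ->
  continuous (rl_integral a f).
Proof.
move=> a0 cf.
have c_h : continuous (fun s => f s - f 0).
  by move=> x; apply: cvgB; [exact: cf|exact: cvg_cst].
pose h s := f s - f 0.
pose h0 s := h (Num.max s 0).
have h0E s : causal h s = h0 s.
  rewrite /causal /h0; case: leP => // s0.
  by rewrite /h subrr.
have ch0 : continuous h0.
  move=> s; apply: (@continuous_comp _ _ _ (fun x => Num.max x 0) h).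
    exact: continuous_maxr.
  exact: c_h.
have -> : rl_integral a f =
    (fun t => rl_integral a h t + f 0 * rl_kernel (a + 1) t).
  apply/funext => t; rewrite -rl_integral_cst// -rl_integralD//; last first.
    by move=> x; exact: cvg_cst.
  by apply: rl_integral_eq => s _; rewrite /h subrK.
move=> t0; apply: cvgD; last first.
  by apply: cvgMr; exact: continuous_rl_kernelS.
pose T := `|t0| + 1.
have T0 : 0 < T by exact: ltr_pwDr.
have tT : t0 \in `]- T, T[%classic.
  by rewrite inE/= in_itv/= -ltr_norml ltrDl.
have [M M0 hM] := continuous_bounded_itv 0 T c_h.
have h0M s : s <= T -> `|h0 s| <= M.
  move=> sT; apply: hM; rewrite le_max lexx orbT/=.
  by rewrite ge_max sT ltW.
have := @continuity_under_integral R _ _ mu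
  (fun t u => rl_kernel a u * h0 (t - u)) `]0, T]%classic (measurable_itv _)
  (- T) T _ _ (fun u => M * rl_kernel a u) _ _ t0 tT.
have ik := integrable_rl_kernel T a0.
have ik2 t : t <= T -> mu.-integrable `]0, T]
    (EFin \o (fun u : R => rl_kernel a u * h0 (t - u))).
  move=> tT'; have -> : EFin \o (fun u : R => rl_kernel a u * h0 (t - u)) =
    ((EFin \o rl_kernel a) \* (EFin \o (fun u : R => h0 (t - u)%R)))%E by [].
  apply: integrableMl => //.
    apply: measurable_funTS; apply: measurableT_comp.
      exact: continuous_measurable_fun.
    exact: measurable_funB.
  exists M; split; first exact: num_real.
  move=> N MN u; rewrite /= in_itv/= => /andP[u0 _].
  by rewrite (le_trans _ (ltW MN))// h0M// lerBlDr (le_trans tT')// lerDl ltW.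
move=> C; have {C} : {for t0, continuous
    (fun t => \int[mu]_(u in `]0, T]) (rl_kernel a u * h0 (t - u)))}.
  apply: C.
  - by move=> t /=; rewrite in_itv/= => /andP[_ tT']; apply: ik2; exact: ltW.
  - apply: nearW => u _ t _; apply: cvgMr.
    apply: (@continuous_comp _ _ _ (fun t => t - u) h0); last exact: ch0.
    by apply: cvgB; [exact: cvg_id|exact: cvg_cst].
  - rewrite (_ : _ \o _ = (fun u => M%:E * (EFin \o rl_kernel a) u)%E)//.
    exact: integrableZl.
  - move=> t /=; rewrite in_itv/= => /andP[_ tT'].
    apply: nearW => u /=; rewrite in_itv/= => /andP[u0 _].
    rewrite normrM ger0_norm ?rl_kernel_ge0// mulrC ler_wpM2r ?rl_kernel_ge0//.
    by rewrite h0M// lerBlDr (le_trans (ltW tT'))// lerDl ltW.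
rewrite /prop_for /continuous_at.
rewrite [X in _ --> X -> _](_ : _ = rl_integral a h t0); last first.
  rewrite (@rl_integral_reflect _ _ _ T)//; last first.
    by move: tT; rewrite inE/= in_itv/= => /andP[_ /ltW].
  by apply: eq_Rintegral => u _; rewrite h0E.
apply: cvg_trans; apply: near_eq_cvg.
near=> t; rewrite (@rl_integral_reflect _ _ _ T)//; last first.
  apply: ltW; near: t; apply: lt_nbhsl.
  by move: tT; rewrite inE/= in_itv/= => /andP[_].
by apply: eq_Rintegral => u _; rewrite h0E.
Unshelve. all: by end_near. Qed.

(** For f >= 0 this is associativity of the convolution; a continuous f is the
difference of max(f, 0) and max(f, 0) - f. *)
Lemma rl_integral_semigroup a b f t : 0 < a -> 0 < b -> continuous f ->
  rl_integral a (rl_integral b f) t = rl_integral (a + b) f t.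
Proof.
move=> a0 b0 cf.
have ge0 g : continuous g -> (forall s, 0 <= g s) ->
    rl_integral a (rl_integral b g) t = rl_integral (a + b) g t.
  move=> cg g0; have ab0 := addr_gt0 a0 b0.
  apply: EFin_inj.
  rewrite EFin_rl_integral//; last exact: continuous_rl_integral.
  rewrite EFin_rl_integral// -conv_rl_kernel//.
  have mk c : measurable_fun setT (EFin \o @rl_kernel R c).
    by apply/measurable_EFinP; exact: measurable_rl_kernel.
  rewrite -convA//; last 4 first.
  - apply/measurable_EFinP; apply: measurable_causal.
    exact: continuous_measurable_fun.
  - by move=> x; rewrite lee_fin rl_kernel_ge0.
  - by move=> x; rewrite lee_fin rl_kernel_ge0.
  - by move=> x; rewrite lee_fin /causal; case: ifP.
  congr (conv _ _ _); apply/funext => s; rewrite /= -EFin_rl_integral//.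
  rewrite /causal; case: ifPn => //; rewrite -leNgt => s0.
  by rewrite rl_integral_le0.
pose p (s : R) : R := Num.max (f s) 0.
have cp : continuous p.
  move=> s; apply: (@continuous_comp _ _ _ f (fun x : R => Num.max x 0)).
    exact: cf.
  exact: continuous_maxr.
have cn : continuous (fun s => p s - f s).
  by move=> s; apply: cvgB; [exact: cp|exact: cf].
have fE : f = (fun s => p s - (p s - f s)).
  by apply/funext => s; rewrite subKr.
have ab0 := addr_gt0 a0 b0.
rewrite fE (rl_integralB _ ab0 cp cn).
have -> : rl_integral b (fun s => p s - (p s - f s)) =
   (fun s => rl_integral b p s - rl_integral b (fun s => p s - f s) s).
  by apply/funext => s; rewrite rl_integralB.
rewrite rl_integralB//; [|exact: continuous_rl_integral..].
rewrite !ge0// => s; rewrite /p ?le_max ?lexx ?orbT//.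
by rewrite subr_ge0 le_max lexx.
Qed.

Lemma rl_integral1E f t : continuous f ->
  rl_integral 1 f t = \int[mu]_(s in `]0, t]) f s.
Proof.
move=> cf; have mf : measurable_fun setT f := continuous_measurable_fun cf.
rewrite /rl_integral /Rintegral; congr fine.
rewrite -integral_itv_bndo_bndc; last first.
  apply/measurable_EFinP/measurable_funTS.
  exact: measurable_rl_integrand.
rewrite -integral_itv_bndo_bndc; last first.
  by apply/measurable_EFinP/measurable_funTS.
apply: eq_integral => s; rewrite inE/= in_itv/= => /andP[_ st].
by rewrite rl_kernel1 subr_gt0 st mul1r.
Qed.

Lemma is_derive_rl_integral1 f t : continuous f -> 0 < t ->
  is_derive t 1 (rl_integral 1 f) (f t).
Proof.
move=> cf t0.
have -> : rl_integral 1 f = (fun x => \int[mu]_(s in `]0, x]) f s).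
  by apply/funext => x; exact: rl_integral1E.
have t1 : t < t + 1 by rewrite ltrDl.
have fi : mu.-integrable `]0, t + 1] (EFin \o f).
  apply: (@integrableS _ _ _ mu `[0, t + 1]%classic) => //.
    exact: subset_itv_oc_cc.
  apply: continuous_compact_integrable; first exact: segment_compact.
  exact: continuous_subspaceT.
have lt0t : (BRight 0 < BRight t)%O by [].
have [] := continuous_FTC1 t1 fi lt0t (cf t).
by move=> d1 d2; split; [exact: d1|rewrite -derive1E; exact: d2].
Qed.

Lemma eq_itvoo_itvcc f g : continuous f -> continuous g ->
  (forall t, 0 < t < 1 -> f t = g t) -> forall t, 0 <= t <= 1 -> f t = g t.
Proof.
move=> cf cg fg t /andP[]; rewrite le_eqVlt => /predU1P[<- _|t0].
  apply: (@cvg_unique _ _ (f x @[x --> 0^'+]))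
    (cvg_at_right_filter (cf 0)) _ => //.
  apply: (cvg_trans _ (cvg_at_right_filter (cg 0))).
  by apply: near_eq_cvg; near=> x; apply/esym/fg/andP; split.
rewrite le_eqVlt => /predU1P[->|t1]; last by apply: fg; rewrite t0.
apply: (@cvg_unique _ _ (f x @[x --> 1^'-]))
  (cvg_at_left_filter (cf 1)) _ => //.
apply: (cvg_trans _ (cvg_at_left_filter (cg 1))).
by apply: near_eq_cvg; near=> x; apply/esym/fg/andP; split.
Unshelve. all: by end_near. Qed.

Lemma rl_integral1_inj f g : continuous f -> continuous g ->
  (forall t, 0 <= t <= 1 -> rl_integral 1 f t = rl_integral 1 g t) ->
  forall t, 0 <= t <= 1 -> f t = g t.
Proof.
move=> cf cg fg; apply: eq_itvoo_itvcc => // t /andP[t0 t1].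
have [_ <-] := is_derive_rl_integral1 cf t0.
have [_ <-] := is_derive_rl_integral1 cg t0.
apply: near_eq_derive => //; near=> x; apply: fg; apply/andP; split.
  by apply: ltW; near: x; exact: lt_nbhsr.
by apply: ltW; near: x; exact: lt_nbhsl.
Unshelve. all: by end_near. Qed.

End riemann_liouville_theory.

(** * The initial value problem as a Volterra equation *)
Section strain_volterra.
Context {R : realType}.
Notation mu := (@lebesgue_measure R).
Implicit Types (a b t x : R) (f g : R -> R).

(** Stresses and strains are only continuous on [0, 1].  Precomposing with the
projection onto [0, 1] makes them continuous on the line without changing any
integral over a subinterval of [0, 1]. *)
Definition clamp01 f (x : R) : R := f (Num.max (Num.min x 1) 0).

Lemma clamp01E f t : 0 <= t <= 1 -> clamp01 f t = f t.
Proof. by move=> /andP[t0 t1]; rewrite /clamp01 min_l// max_l. Qed.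

Lemma clamp01_itv t : 0 <= Num.max (Num.min t 1) 0 <= 1.
Proof. by rewrite le_max lexx orbT/= ge_max ler01 andbT ge_min lexx orbT. Qed.

Lemma continuous_clamp01 f : {within `[0, 1], continuous f} ->
  continuous (clamp01 f).
Proof.
move=> cf x; pose k (y : R) : R := Num.max (Num.min y 1) 0.
have ck : continuous k.
  have -> : k = (fun y => Num.max (- Num.max (- y) (-1)) 0).
    by apply/funext => y; rewrite /k oppr_max !opprK.
  move=> y; apply: (@continuous_comp _ _ _ (fun y : R => - Num.max (- y) (-1))
    (fun y : R => Num.max y 0)); last exact: continuous_maxr.
  apply: cvgN; apply: (@continuous_comp _ _ _ (fun y : R => - y)
    (fun y : R => Num.max y (-1))); last exact: continuous_maxr.
  exact: opp_continuous.
have kI y : `[0, 1]%classic (k y) by rewrite /= in_itv/=; exact: clamp01_itv.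
move/subspace_continuousP : cf => /(_ (k x) (kI x)); apply: cvg_comp.
move=> P /ck WP.
apply: (@filterS _ (nbhs x) _ (fun y => `[0, 1]%classic (k y) -> P (k y))) WP.
by move=> y; apply; exact: kI.
Qed.

Lemma is_derive_quotientP f t d : is_derive t 1 f d <->
  (fun s => (f s - f t) / (s - t)) @ t^' --> d.
Proof.
split.
- move=> [df <-]; move: df; rewrite /derivable => /cvgrPdist_lt df.
  apply/cvgrPdist_lt => e e0; have [r /= r0 hr] := df e e0.
  exists r => //= s; rewrite /= => ts sNt.
  have := hr (s - t); rewrite /= sub0r normrN distrC => /(_ ts).
  rewrite subr_eq0 => /(_ sNt).
  by rewrite scaler1 subrK [in X in _ -> X]mulrC.
- move=> /cvgrPdist_lt df.
  have c : (fun h => h^-1 *: ((f \o shift t) (h *: 1) - f t)) @ 0^' --> d.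
    apply/cvgrPdist_lt => e e0; have [r /= r0 hr] := df e e0.
    exists r => //= h; rewrite /= sub0r normrN => hr0 h0.
    have := hr (h + t); rewrite /= opprD addrCA subrr addr0 normrN => /(_ hr0).
    rewrite -subr_eq0 addrK => /(_ h0).
    by rewrite scaler1 [in X in _ -> X]/GRing.scale/= mulrC.
  split; first by apply/cvg_ex; exists d.
  exact/cvg_lim.
Qed.

Lemma has_derivative_within_eq (D : set R) f g t d : D t ->
  (forall s, D s -> f s = g s) ->
  has_derivative_within D f t d -> has_derivative_within D g t d.
Proof.
move=> Dt fg; apply: cvg_trans; apply: near_eq_cvg.
rewrite near_withinE; apply: nearW => s Ds.
by rewrite !fg.
Qed.

Lemma is_derive_within (D : set R) f t d :
  is_derive t 1 f d -> has_derivative_within D f t d.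
Proof. by move=> /is_derive_quotientP; exact: cvg_within_filter. Qed.

Lemma within_is_derive f t d : 0 < t < 1 ->
  has_derivative_within `[0, 1] f t d -> is_derive t 1 f d.
Proof.
move=> /andP[t0 t1] h; apply/is_derive_quotientP.
have N : t^' `[0, 1]%classic.
  near=> s; rewrite /= in_itv/=; apply/andP; split; apply: ltW; near: s;
  by apply: nbhs_dnbhs; first [exact: lt_nbhsr|exact: lt_nbhsl].
apply: cvg_trans h => P WP.
by apply: (@filterS2 _ t^' _ (fun s => `[0, 1]%classic s ->
  P ((f s - f t) / (s - t))) `[0, 1]%classic) WP N => s; apply.
Unshelve. all: by end_near. Qed.

(** At s = u both kernels are 0, by the convention 0 `^ (- a) = 0. *)
Lemma caputo_rl_integral a f u : 0 < a < 1 -> continuous f ->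
  \int[mu]_(s in `[0, u]) ((u - s) `^ (- a) * f s) =
  Gamma (1 - a) * rl_integral (1 - a) f u.
Proof.
move=> /andP[a0 a1] cf; have a10 : 0 < 1 - a by rewrite subr_gt0.
have E s : 0 < s <= u -> (u - s) `^ (- a) * f s =
    Gamma (1 - a) * (rl_kernel (1 - a) (u - s) * f s).
  move=> /andP[s0 su]; rewrite mulrA; congr (_ * _).
  rewrite /rl_kernel mulrCA divff ?gt_eqF ?Gamma_gt0// mulr1 /power_kernel.
  case: ifPn => us; first by congr powR; ring.
  have -> : u - s = 0 by apply/eqP; rewrite eq_le subr_ge0 su leNgt us.
  by rewrite powR0// oppr_eq0 gt_eqF.
have ir := integrable_rl u a10 cf.
rewrite -Rintegral_itv_obnd_cbnd; last first.
  apply: (@eq_integrable _ _ _ mu `]0, u]%classic (measurable_itv _)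
    (fun s : R => ((Gamma (1 - a))%:E *
      (rl_kernel (1 - a) (u - s) * f s)%:E)%E)) => //; last exact: integrableZl.
  by move=> s; rewrite inE/= in_itv/= => su; rewrite -EFinM E.
rewrite /rl_integral -RintegralZl//; apply: eq_Rintegral => s.
by rewrite inE/= in_itv/= => /E.
Qed.

Definition volterra a (c lam : R) (s e : R -> R) := forall t, 0 <= t <= 1 ->
  e t = c * rl_integral a s t - lam * rl_integral a e t.

Variables (alpha E eta : R).
Hypotheses (halpha : 0 < alpha < 1) (heta : 0 < eta).

Definition gain : R := (eta `^ alpha)^-1.
Definition rate : R := E `^ alpha / eta `^ alpha.

Let forcing (s e : R -> R) t := gain * s t - rate * e t.

Let continuous_forcing (s e : R -> R) : continuous s -> continuous e ->
  continuous (forcing s e).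
Proof.
move=> cs ce x; apply: cvgB; first by apply: cvgMr; exact: cs.
by apply: cvgMr; exact: ce.
Qed.

Let forcingE (s e : R -> R) t : continuous s -> continuous e ->
  rl_integral alpha (forcing s e) t =
  gain * rl_integral alpha s t - rate * rl_integral alpha e t.
Proof.
move=> cs ce; have /andP[a0 _] := halpha.
have cM (c : R) f : continuous f -> continuous (fun x => c * f x).
  by move=> cf x; apply: cvgMr; exact: cf.
rewrite rl_integralB//; [|exact: cM..].
by rewrite !rl_integralZ.
Qed.

(** Two primitives of the forcing that vanish at 0 agree, so I^(1-alpha) eps is
I^1 of the forcing; apply I^alpha and differentiate. *)
Lemma strain_volterra (sigma eps : R -> R) :
  {within `[0, 1], continuous sigma} -> is_strain alpha E eta sigma eps ->
  volterra alpha gain rate (clamp01 sigma) (clamp01 eps).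
Proof.
move=> csigma [ceps eps0 heq].
have /andP[a0 a1] := halpha; have a10 : 0 < 1 - alpha by rewrite subr_gt0.
set s := clamp01 sigma; set e := clamp01 eps.
have cs : continuous s by exact: continuous_clamp01.
have ce : continuous e by exact: continuous_clamp01.
set g := forcing s e; have cg : continuous g by exact: continuous_forcing.
have dRL t : 0 < t < 1 -> is_derive t 1 (rl_integral (1 - alpha) e) (g t).
  move=> t01; have /andP[t0 t1] := t01.
  have t01' : 0 <= t <= 1 by rewrite !ltW.
  have [|d [d' dd' dE] sE] := heq t; first by rewrite t0 ltW.
  have gE : g t = d.
    rewrite /g /forcing /s /e !clamp01E// -sE /gain /rate.
    by field; rewrite gt_eqF// powR_gt0.
  rewrite gE dE; apply: within_is_derive => //.
  have Gn0 : Gamma (1 - alpha) != 0 by rewrite gt_eqF// Gamma_gt0.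
  apply: (@has_derivative_within_eq _ (fun u => (Gamma (1 - alpha))^-1 *
    \int[mu]_(s in `[0, u]) ((u - s) `^ (- alpha) * (eps s - eps 0)))).
  - by rewrite /= in_itv.
  - move=> u; rewrite /= in_itv/= => u01.
    rewrite (_ : \int[mu]_(s in `[0, u]) _ =
        \int[mu]_(s in `[0, u]) ((u - s) `^ (- alpha) * e s)); last first.
      apply: eq_Rintegral => v; rewrite inE/= in_itv/= => /andP[v0 vu].
      rewrite eps0 subr0 /e clamp01E// v0 (le_trans vu)//.
      by case/andP: u01.
    by rewrite caputo_rl_integral// mulKf.
  - rewrite /has_derivative_within.
    under eq_fun do rewrite -mulrBr -mulrA.
    exact: cvgMr.
pose F u := rl_integral (1 - alpha) e u - rl_integral 1 g u.
have F0 t : 0 <= t <= 1 -> rl_integral (1 - alpha) e t = rl_integral 1 g t.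
  move=> /andP[t0 t1].
  have dF x : x \in `]0, t[ -> is_derive x 1 F ((fun=> 0) x).
    rewrite in_itv/= => /andP[x0 xt]; rewrite -(subrr (g x)).
    apply: is_deriveB; first by apply: dRL; rewrite x0 (lt_le_trans xt).
    exact: is_derive_rl_integral1.
  have cF : {within `[0, t], continuous F}.
    apply: continuous_subspaceT => x.
    by apply: cvgB; exact: continuous_rl_integral.
  have [x _] := MVT_segment t0 dF cF.
  rewrite mul0r /F !(rl_integral_le0 _ _ (lexx 0)) subrr subr0 => /eqP.
  by rewrite subr_eq0 => /eqP.
move=> t t01; rewrite -forcingE// -/g.
apply: rl_integral1_inj t t01 => //; first exact: continuous_rl_integral.
move=> t t01.
rewrite rl_integral_semigroup// addrC -rl_integral_semigroup//.
transitivity (rl_integral alpha (rl_integral (1 - alpha) e) t).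
  by rewrite [RHS](rl_integral_semigroup _ a0 a10 ce) addrC subrK.
apply: rl_integral_eq => x /andP[x0 xt]; apply: F0.
by rewrite ltW//= (le_trans xt)//; case/andP : t01.
Qed.

(** By the semigroup law, I^(1-alpha) of the right-hand side of the Volterra
equation is I^1 of the forcing, whose derivative is the forcing. *)
Lemma volterra_strain (sigma e : R -> R) : {within `[0, 1], continuous sigma} ->
  continuous e -> volterra alpha gain rate (clamp01 sigma) e ->
  is_strain alpha E eta sigma e.
Proof.
move=> csigma ce ve.
have /andP[a0 a1] := halpha; have a10 : 0 < 1 - alpha by rewrite subr_gt0.
set s := clamp01 sigma in ve *.
have cs : continuous s by exact: continuous_clamp01.
set g := forcing s e; have cg : continuous g by exact: continuous_forcing.
have e0 : e 0 = 0.
  rewrite ve ?lexx ?ler01// !(rl_integral_le0 _ _ (lexx 0)).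
  by rewrite !mulr0 subrr.
split => //; first exact: continuous_subspaceT.
move=> t /andP[t0 t1]; have t01 : 0 <= t <= 1 by rewrite ltW.
exists (g t); last first.
  rewrite /g /forcing /s clamp01E// /gain /rate.
  by field; rewrite gt_eqF// powR_gt0.
exists (Gamma (1 - alpha) * g t); last first.
  by rewrite mulKf// gt_eqF// Gamma_gt0.
apply: (@has_derivative_within_eq _
    (fun u => Gamma (1 - alpha) * rl_integral 1 g u)).
- by rewrite /= in_itv/= t01.
- move=> u; rewrite /= in_itv/= => /andP[u0 u1].
  under [RHS]eq_Rintegral do rewrite e0 subr0.
  rewrite caputo_rl_integral//; congr (_ * _).
  transitivity (rl_integral (1 - alpha) (rl_integral alpha g) u).
    by rewrite [RHS](rl_integral_semigroup _ a10 a0 cg) subrK.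
  apply: rl_integral_eq => x /andP[x0 xu].
  by rewrite forcingE// ve// ltW//= (le_trans xu).
- apply: is_derive_within; apply: is_deriveZ.
  exact: is_derive_rl_integral1.
Qed.

End strain_volterra.

(** * Solution of the Volterra equation by its Neumann series *)
Section volterra_series.
Context {R : realType}.
Implicit Types (a t x : R) (f g : R -> R).

(** The Weierstrass test at one point, with the remainder bounded by that of the
majorant, which makes the convergence uniform. *)
Lemma series_tail_le (u b : R^nat) : (forall n, `|u n| <= b n) ->
  cvgn (series b) ->
  (series u @ \oo --> limn (series u)) /\
  (forall n, `|limn (series u) - series u n| <= limn (series b) - series b n).
Proof.
move=> ub cb; have cu : cvgn (series u).
  apply: normed_cvg; apply: (series_le_cvg _ _ ub cb) => n.
    exact: normr_ge0.
  exact: le_trans (normr_ge0 _) (ub n).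
split => // n.
have cun : (fun p => `|series u p - series u n|) @ \oo -->
    `|limn (series u) - series u n|.
  by apply: cvg_norm; apply: cvgB => //; exact: cvg_cst.
have cbn : (fun p => series b p - series b n) @ \oo -->
    limn (series b) - series b n.
  by apply: cvgB => //; exact: cvg_cst.
apply: (ler_cvg_to cun cbn); exists n => // p /= np.
rewrite !sub_series_geq//; apply: le_trans (ler_norm_sum _ _ _) _.
by apply: ler_sum => i _; exact: ub.
Qed.

Lemma seriesS_shift (u : R^nat) :
  series (fun n => u n.+1) = (fun n => series u n.+1 - u 0).
Proof.
apply/funext => n; rewrite !seriesEord/= big_ord_recl/= addrC addKr.
by apply: eq_bigr.
Qed.

Lemma uniform_limit_continuous_real (F : nat -> R -> R) f (r : R^nat) :
  (forall n, continuous (F n)) -> (forall n t, `|f t - F n t| <= r n) ->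
  r @ \oo --> 0 -> continuous f.
Proof.
move=> cF fF r0 t; apply/cvgrPdist_lt => e e0.
have e3 : 0 < e / 3 by rewrite divr_gt0.
have /cvgrPdist_lt/(_ _ e3)[N _ /(_ N (leqnn N))/=] := r0.
rewrite sub0r normrN => rN.
have rN' : r N < e / 3 := le_lt_trans (ler_norm _) rN.
have /cvgrPdist_lt/(_ _ e3) := cF N t; apply: filterS => x.
move=> Ft; rewrite (_ : f t - f x = (f t - F N t) + (F N t - F N x) +
  (F N x - f x)); last by ring.
rewrite (_ : e = e / 3 + e / 3 + e / 3); last by field.
apply: le_lt_trans (ler_normD _ _) _; apply: ltrD.
  apply: le_lt_trans (ler_normD _ _) _; apply: ltrD => //.
  exact: le_lt_trans (fF _ _) rN'.
by rewrite distrC; exact: le_lt_trans (fF _ _) rN'.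
Qed.

Lemma is_cvg_mittag_leffler_series a x : 0 < a -> 0 <= x ->
  cvgn (series (fun n => x ^+ n / Gamma (a * n%:R + 1))).
Proof.
(* A ^ a = 2 x + 1, so Gamma_lb makes the terms at most exp(A) / 2 ^ n. *)
move=> a0 x0; pose y := 2 * x + 1; pose A := y `^ a^-1.
have y0 : 0 < y by rewrite ltr_wpDl// mulr_ge0.
have A0 : 0 < A by exact: powR_gt0.
have AaE : A `^ a = y.
  by rewrite /A -powRrM mulVf ?gt_eqF// powRr1// ltW.
have G0 n : 0 < Gamma (a * n%:R + 1).
  by rewrite Gamma_gt0// ltr_wpDl// mulr_ge0// ltW.
have hG : cvgn (series (geometric (expR A) (2^-1))).
  by apply: is_cvg_geometric_series; rewrite ger0_norm// invf_lt1// ltr1n.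
apply: (series_le_cvg _ _ _ hG) => n /=.
- by rewrite divr_ge0 ?exprn_ge0// ltW.
- by rewrite mulr_ge0 ?expR_ge0// exprn_ge0.
have an0 : 0 <= a * n%:R by rewrite mulr_ge0// ltW.
have := Gamma_lb A0 an0; rewrite powRrM AaE powR_mulrn; last exact: ltW.
rewrite expRN => hlb.
rewrite ler_pdivrMr//; apply: le_trans (ler_wpM2l _ hlb); last first.
  by rewrite mulr_ge0 ?expR_ge0// exprn_ge0.
rewrite (_ : _ * _ = (2^-1 * y) ^+ n); last first.
  rewrite /geometric/= exprMn; move: (2^-1 ^+ n) (y ^+ n) => p q.
  by field; rewrite gt_eqF ?expR_gt0.
rewrite lerXn2r ?nnegrE//; first by rewrite mulr_ge0 // ltW.
by rewrite /y mulrDr mulrA mulVf// mul1r lerDl mulr1 invr_ge0.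
Qed.

Lemma rl_kernelS_le1 a t : 0 < a -> t <= 1 ->
  rl_kernel (a + 1) t <= (Gamma (a + 1))^-1.
Proof.
move=> a0 t1; apply: le_trans (rl_kernelS_homo a0 t1) _.
by rewrite rl_kernelS// powR1 mul1r.
Qed.

Variables (alpha c lam : R).
Hypotheses (a0 : 0 < alpha) (lam0 : 0 < lam).

(** The order of the integral reached at the n-th iteration. *)
Definition frac_order (n : nat) : R := alpha * n.+1%:R.

Lemma frac_order_gt0 n : 0 < frac_order n.
Proof. by rewrite mulr_gt0. Qed.

Lemma frac_order0 : frac_order 0 = alpha.
Proof. by rewrite /frac_order mulr1. Qed.

Lemma frac_orderS n : frac_order n.+1 = alpha + frac_order n.
Proof. by rewrite /frac_order -[n.+2%:R]nat1r mulrDr mulr1. Qed.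

Definition neumann_term s n t : R :=
  (- lam) ^+ n * c * rl_integral (frac_order n) s t.

Definition neumann_sum s n t : R := series (neumann_term s ^~ t) n.

Definition majorant (n : nat) : R := lam ^+ n / Gamma (frac_order n + 1).

Lemma is_cvg_majorant : cvgn (series majorant).
Proof.
pose m n := lam ^+ n / Gamma (alpha * n%:R + 1).
have h : cvgn (series m).
  by apply: is_cvg_mittag_leffler_series => //; exact: ltW.
have -> : majorant = (fun n => lam^-1 * m n.+1).
  apply/funext => n; rewrite /majorant /m exprS !mulrA mulVf ?mul1r//.
  by rewrite gt_eqF.
apply: is_cvg_seriesZ; rewrite seriesS_shift.
apply: is_cvgB; last exact: is_cvg_cst.
apply/cvg_ex; exists (limn (series m)).
by move: h; rewrite -(cvg_shiftS (series m)).
Qed.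

Lemma neumann_term_bound s n t M : continuous s ->
  (forall x, 0 <= x <= 1 -> `|s x| <= M) -> 0 <= t <= 1 ->
  `|neumann_term s n t| <= `|c| * M * majorant n.
Proof.
move=> cs sM /andP[t0 t1].
have M0 : 0 <= M by apply: le_trans (sM 0 _) => //; rewrite lexx ler01.
rewrite /neumann_term !normrM normrX normrN (gtr0_norm lam0) /majorant.
have -> : `|c| * M * (lam ^+ n / Gamma (frac_order n + 1)) =
  lam ^+ n * `|c| * (M * (Gamma (frac_order n + 1))^-1) by ring.
rewrite ler_wpM2l ?mulr_ge0 ?exprn_ge0 ?(ltW lam0)//.
apply: le_trans (@rl_integral_bound _ _ _ _ M (frac_order_gt0 n) cs _) _;
  last first.
  by rewrite ler_wpM2l// rl_kernelS_le1// frac_order_gt0.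
by move=> x /andP[x0 xt]; rewrite sM// ltW//= (le_trans xt).
Qed.

Lemma continuous_neumann_term s n : continuous s ->
  continuous (neumann_term s n).
Proof.
move=> cs x; apply: cvgMr.
by apply: continuous_rl_integral => //; exact: frac_order_gt0.
Qed.

Lemma neumann_sum0 s t : neumann_sum s 0 t = 0.
Proof. by rewrite /neumann_sum seriesEord/= big_ord0. Qed.

Lemma neumann_sumS s n t :
  neumann_sum s n.+1 t = neumann_sum s n t + neumann_term s n t.
Proof. exact: seriesSr. Qed.

Lemma continuous_neumann_sum s n : continuous s ->
  continuous (neumann_sum s n).
Proof.
move=> cs; elim: n => [|n IH] x.
  have -> : neumann_sum s 0 = (fun=> 0).
    by apply/funext => y; exact: neumann_sum0.
  exact: cvg_cst.
have -> : neumann_sum s n.+1 =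
    (fun t => neumann_sum s n t + neumann_term s n t).
  by apply/funext => y; exact: neumann_sumS.
by apply: cvgD; [exact: IH|exact: continuous_neumann_term].
Qed.

Lemma neumann_termS s n t : continuous s ->
  neumann_term s n.+1 t = - lam * rl_integral alpha (neumann_term s n) t.
Proof.
move=> cs; have on0 := frac_order_gt0 n.
have crl : continuous (rl_integral (frac_order n) s).
  exact: continuous_rl_integral.
rewrite /neumann_term frac_orderS (rl_integralZ _ _ a0 crl).
by rewrite (rl_integral_semigroup t a0 on0 cs) exprS; ring.
Qed.

(** The partial sums are the successive approximations of the Volterra equation
started from 0. *)
Lemma neumann_sum_fixpoint s n t : continuous s ->
  neumann_sum s n.+1 t =
  c * rl_integral alpha s t - lam * rl_integral alpha (neumann_sum s n) t.
Proof.
move=> cs; elim: n => [|n IH].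
  rewrite neumann_sumS neumann_sum0 add0r.
  rewrite (@rl_integral_eq _ _ (neumann_sum s 0) (fun=> 0)); last first.
    by move=> x _; exact: neumann_sum0.
  rewrite rl_integral_cst// mul0r mulr0 subr0.
  by rewrite /neumann_term frac_order0 mul1r.
rewrite neumann_sumS IH neumann_termS//.
rewrite (@rl_integral_eq _ _ (neumann_sum s n.+1)
  (fun t => neumann_sum s n t + neumann_term s n t)); last first.
  by move=> x _; exact: neumann_sumS.
rewrite (rl_integralD _ a0); [by ring| |].
- exact: continuous_neumann_sum.
- exact: continuous_neumann_term.
Qed.

(** Substitute the equation into the remainder n times. *)
Lemma volterra_remainder s e n t : continuous s -> continuous e ->
  volterra alpha c lam s e ->
  0 <= t <= 1 ->
  e t - neumann_sum s n.+1 t =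
  (- lam) ^+ n.+1 * rl_integral (frac_order n) e t.
Proof.
move=> cs ce ve t01; elim: n => [|n IH].
  rewrite neumann_sumS neumann_sum0 add0r /neumann_term frac_order0 (ve _ t01).
  by ring.
rewrite neumann_sumS opprD addrA IH {IH}.
have on0 := frac_order_gt0 n.
have cRL f : continuous f -> continuous (rl_integral alpha f).
  by move=> cf; exact: continuous_rl_integral.
have cM k f : continuous f -> continuous (fun t => k * rl_integral alpha f t).
  by move=> cf x; apply: cvgMr; exact: cRL.
rewrite (@rl_integral_eq _ (frac_order n) e
  (fun t => c * rl_integral alpha s t - lam * rl_integral alpha e t));
  last first.
  move=> x /andP[x0 xt]; apply: ve; rewrite ltW//= (le_trans xt)//.
  by case/andP: t01.
rewrite (rl_integralB _ on0 (cM c _ cs) (cM lam _ ce)).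
rewrite (rl_integralZ c _ on0 (cRL _ cs)) (rl_integralZ lam _ on0 (cRL _ ce)).
rewrite (rl_integral_semigroup t on0 a0 cs) (rl_integral_semigroup t on0 a0 ce).
by rewrite /neumann_term frac_orderS [alpha + _]addrC !exprS; ring.
Qed.

Lemma majorant_cvg0 : majorant @ \oo --> 0.
Proof. exact: cvg_series_cvg_0 is_cvg_majorant. Qed.

(** Uniqueness: any solution is bounded on [0, 1], so the remainder of the
iteration is controlled by the terms of a convergent series. *)
Lemma volterra_neumann s e t : continuous s -> continuous e ->
  volterra alpha c lam s e ->
  0 <= t <= 1 ->
  (fun n => neumann_sum s n t) @ \oo --> e t.
Proof.
move=> cs ce ve t01; rewrite -(cvg_shiftS (fun n => neumann_sum s n t)).
have [M M0 hM] := continuous_bounded_itv 0 1 ce.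
have r0 : (fun n => lam * M * majorant n) @ \oo --> 0.
  by rewrite -(mulr0 (lam * M)); apply: cvgMr; exact: majorant_cvg0.
apply/cvgrPdist_le => d d0.
have /cvgrPdist_le/(_ _ d0) := r0; apply: filterS => n.
rewrite sub0r normrN => /(le_trans (ler_norm _)); apply: le_trans.
rewrite /= (volterra_remainder n cs ce ve t01).
rewrite normrM normrX normrN (gtr0_norm lam0).
have -> : lam * M * majorant n =
  lam ^+ n.+1 * (M * (Gamma (frac_order n + 1))^-1).
  by rewrite /majorant exprS; ring.
rewrite ler_wpM2l ?exprn_ge0 ?(ltW lam0)//.
have /andP[t0 t1] := t01.
apply: le_trans (@rl_integral_bound _ _ _ _ M (frac_order_gt0 n) ce _) _;
  last first.
  by rewrite ler_wpM2l// rl_kernelS_le1// frac_order_gt0.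
by move=> x /andP[x0 xt]; rewrite hM// ltW//= (le_trans xt).
Qed.

(** The series converges uniformly on [0, 1], hence to a continuous function,
and I^alpha is continuous for the uniform norm, so that the recursion between
partial sums passes to the limit. *)
Lemma volterra_exists s : continuous s -> exists2 e : R -> R,
  continuous e & volterra alpha c lam s e.
Proof.
move=> cs; have [M M0 hM] := continuous_bounded_itv 0 1 cs.
pose b n := `|c| * M * majorant n.
have cb : cvgn (series b) by apply: is_cvg_seriesZ; exact: is_cvg_majorant.
pose r n := limn (series b) - series b n.
have r0 : r @ \oo --> 0.
  by rewrite -(subrr (limn (series b))); apply: cvgB => //; exact: cvg_cst.
pose e0 t : R := limn (series (neumann_term s ^~ t)).
have he t : 0 <= t <= 1 -> ((fun n => neumann_sum s n t) @ \oo --> e0 t) /\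
    (forall n, `|e0 t - neumann_sum s n t| <= r n).
  move=> t01; apply: (@series_tail_le (neumann_term s ^~ t) b) => //.
  by move=> n; exact: neumann_term_bound.
pose e := clamp01 e0.
have ce : continuous e.
  apply: (@uniform_limit_continuous_real
    (fun n => clamp01 (neumann_sum s n)) e r).
  - move=> n; apply: continuous_clamp01; apply: continuous_subspaceT.
    exact: continuous_neumann_sum.
  - move=> n t; exact: (he _ (clamp01_itv t)).2.
  - exact: r0.
exists e => // t t01; have [et_ _] := he t t01.
have L : (fun n => neumann_sum s n.+1 t) @ \oo -->
    c * rl_integral alpha s t - lam * rl_integral alpha e t.
  under eq_fun do rewrite neumann_sum_fixpoint//.
  apply: cvgB; first exact: cvg_cst.
  apply: cvgMr; apply/cvgrPdist_le => d d0.
  have r0' : (fun n => r n * rl_kernel (alpha + 1) t) @ \oo --> 0.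
    by rewrite -(mul0r (rl_kernel (alpha + 1) t)); apply: cvgMl.
  have /cvgrPdist_le/(_ _ d0) := r0'; apply: filterS => n.
  rewrite sub0r normrN => /(le_trans (ler_norm _)); apply: le_trans.
  rewrite -rl_integralB//; last exact: continuous_neumann_sum.
  apply: rl_integral_bound => //.
    by move=> x; apply: cvgB; [exact: ce|exact: continuous_neumann_sum].
  move=> x /andP[x0 xt]; have x01 : 0 <= x <= 1.
    by rewrite ltW//= (le_trans xt)//; case/andP : t01.
  by rewrite /e clamp01E//; exact: (he _ x01).2.
rewrite {1}/e clamp01E//.
move: et_; rewrite -(cvg_shiftS (fun n => neumann_sum s n t)) => et_.
exact: (cvg_unique _ et_ L).
Qed.

End volterra_series.

(** * Riemann-Stieltjes sums against the kernels *)
Section riemann_stieltjes.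
Context {R : realType}.
Notation mu := (@lebesgue_measure R).
Implicit Types (a b t x : R) (f g : R -> R).

Lemma integral_rl_kernel_itv b (a t : R) : 0 < b -> a <= t ->
  \int[mu]_(r in `]a, t]) rl_kernel b (t - r) = rl_kernel (b + 1) (t - a).
Proof.
move=> b0 at_; rewrite -[RHS]mul1r -rl_integral_cst// /rl_integral /Rintegral.
congr fine; rewrite integral_mkcond [RHS]integral_mkcond.
have mk (y z : R) : measurable_fun setT
    ((fun r : R => (rl_kernel b (y - r))%:E) \_ `]z, y]).
  apply/(measurable_restrictT _ _).1 => //.
  apply/measurable_EFinP; apply: measurable_funTS.
  apply: measurableT_comp; first exact: measurable_rl_kernel.
  exact: measurable_funB.
rewrite (ge0_integral_shift a (mk t a)); last first.
  by move=> r; rewrite patchE; case: ifP => // _; rewrite lee_fin rl_kernel_ge0.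
apply: eq_integral => r _; rewrite !patchE.
have -> : (r + a \in `]a, t]%classic) = (r \in `]0, t - a]%classic).
  by apply/idP/idP; rewrite !inE/= !in_itv/= lerBrDr => /andP[];
    rewrite ltrDr => -> ->.
by case: ifP => // _; rewrite mulr1; congr (rl_kernel _ _)%:E; ring.
Qed.

(** As phi_(b+1)(t - r) decreases in r at the rate phi_b(t - r), replacing s by
the constant k on ]p, q] costs at most the oscillation w times the total
decrease. *)
Lemma rl_increment b s (t p q k w : R) : 0 < b -> continuous s ->
  0 <= p -> p <= q -> q <= t -> (forall r, p <= r <= q -> `|s r - k| <= w) ->
  `|\int[mu]_(r in `]0, q]) (rl_kernel b (t - r) * s r)
    - \int[mu]_(r in `]0, p]) (rl_kernel b (t - r) * s r)
    - k * (rl_kernel (b + 1) (t - p) - rl_kernel (b + 1) (t - q))| <=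
  w * (rl_kernel (b + 1) (t - p) - rl_kernel (b + 1) (t - q)).
Proof.
move=> b0 cs p0 pq qt sw.
have cc (z : R) : continuous (fun _ : R => z) by move=> y; exact: cvg_cst.
have ii f D : continuous f -> measurable D -> D `<=` `]0, t]%classic ->
    mu.-integrable D (EFin \o (fun r : R => rl_kernel b (t - r) * f r)).
  move=> cf mD Dt; apply: integrableS (integrable_rl t b0 cf) => //.
have sub1 : `]0, q] `<=` `]0, t]%classic.
  by apply: subset_itvl; rewrite bnd_simp.
have sub2 : `]p, q] `<=` `]0, t]%classic.
  by apply: subset_itv; rewrite bnd_simp.
rewrite Rintegral_itvB ?bnd_simp//; last exact: ii.
have kE z : \int[mu]_(r in `]p, q]) (rl_kernel b (t - r) * z) =
    z * (rl_kernel (b + 1) (t - p) - rl_kernel (b + 1) (t - q)).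
  rewrite -(integral_rl_kernel_itv b0 (le_trans pq qt)).
  rewrite -(integral_rl_kernel_itv b0 qt).
  have ik D : measurable D -> D `<=` `]0, t]%classic ->
      mu.-integrable D (EFin \o (fun r : R => rl_kernel b (t - r))).
    move=> mD Dt; rewrite (_ : _ \o _ =
      (EFin \o (fun r : R => rl_kernel b (t - r) * 1))); first exact: ii.
    by apply/funext => r /=; rewrite mulr1.
  have sub3 : `]p, t] `<=` `]0, t]%classic.
    by apply: subset_itvr; rewrite bnd_simp.
  have H := @Rintegral_itvB R (fun r : R => rl_kernel b (t - r))
    (BRight p) (BRight t) q (ik _ (measurable_itv _) sub3).
  rewrite -H ?bnd_simp// subKr.
  rewrite -RintegralZl//; last exact: ik.
  by apply: eq_Rintegral => r _; rewrite mulrC.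
have cdiff : continuous (fun r => s r - k).
  by move=> y; apply: cvgB; [exact: cs|exact: cvg_cst].
rewrite -(kE k) (_ : _ - _ =
    \int[mu]_(r in `]p, q]) (rl_kernel b (t - r) * (s r - k))); last first.
  rewrite -RintegralB//; [|exact: ii|exact: ii].
  by apply: eq_Rintegral => r _; rewrite mulrBr.
rewrite ler_norml -mulNr -(kE w) -(kE (- w)).
apply/andP; split; apply: le_Rintegral => //.
- exact: ii.
- exact: ii.
- move=> r; rewrite /= in_itv/= => /andP[pr rq].
  rewrite ler_wpM2l ?rl_kernel_ge0//.
  by have := sw r; rewrite (ltW pr) rq ler_norml => /(_ isT) /andP[].
- exact: ii.
- exact: ii.
- move=> r; rewrite /= in_itv/= => /andP[pr rq].
  rewrite ler_wpM2l ?rl_kernel_ge0//.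
  by have := sw r; rewrite (ltW pr) rq ler_norml => /(_ isT) /andP[].
Qed.

(** Heine's theorem, by compactness in near-covering form: near each point the
bound holds for all small enough d. *)
Lemma unif_continuous_itv f (a b w : R) : continuous f -> 0 < w ->
  exists2 d : R, 0 < d & forall x y, a <= x <= b -> `|x - y| < d ->
    `|f x - f y| < w.
Proof.
move=> cf w0.
have /compact_near_coveringP cov := @segment_compact R a b.
have H : \forall d \near (0 : R)^'+, `[a, b]%classic `<=`
    (fun x => forall y, `|x - y| < d -> `|f x - f y| < w).
  apply: cov.
  move=> x _; have w2 : 0 < w / 2 by rewrite divr_gt0.
  have /cvgrPdist_lt/(_ _ w2)[r /= r0 hr] := cf x.
  have r2 : 0 < r / 2 by rewrite divr_gt0.
  exists (ball x (r / 2), [set d | d < r / 2]) => /=.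
    split; first exact: nbhsx_ballx.
    exact: nbhs_right_lt.
  move=> [x' d] [/= xx' dr] y xy.
  rewrite (splitr w) -(subrKA (f x)) (le_lt_trans (ler_normD _ _))// ltrD//.
    rewrite distrC; apply: hr => /=.
    by apply: lt_le_trans xx' _; rewrite ler_pdivrMr// ler_peMr ?ler1n ?ltW.
  apply: hr => /=; rewrite -(subrKA x') (le_lt_trans (ler_normD _ _))//.
  by rewrite [ltRHS]splitr ltrD// (lt_trans xy).
have [d /= d0 hd] := H.
exists (d / 2); first by rewrite divr_gt0.
move=> x y xab xy; apply: (hd (d / 2) _ _ x) => //=.
- by rewrite sub0r normrN gtr0_norm ?divr_gt0// ltr_pdivrMr// ltr_pMr// ltr1n.
- by rewrite divr_gt0.
Qed.

Lemma tagged_partition_le (a b : R) n (x xi : nat -> R) i j :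
  tagged_partition a b n x xi -> (i <= j <= n)%N -> x i <= x j.
Proof.
move=> [_ _ tags] /andP[]; elim: j => [|j IH].
  by rewrite leqn0 => /eqP ->.
rewrite leq_eqVlt => /predU1P[-> //|ij] jn.
apply: le_trans (IH ij (ltnW jn)) _.
by have /andP[] := tags _ jn; exact: le_trans.
Qed.

(** Summation by parts exchanges the roles of points and tags: the sum becomes
one of s (x m) times the decrease of F between consecutive tags, that is, a
Riemann sum for the integral P of s against the measure with distribution
function - F.  The hypothesis on increments compares the two between
consecutive tags. *)
Lemma rs_sum_by_parts (s F P : R -> R) (t w d : R) n (x xi : nat -> R) :
  (forall p q k, 0 <= p -> p <= q -> q <= t ->
    (forall r, p <= r <= q -> `|s r - k| <= w) ->
    `|P q - P p - k * (F p - F q)| <= w * (F p - F q)) ->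
  P 0 = 0 -> F t = 0 -> 0 < d ->
  (forall u v, 0 <= u <= t -> `|u - v| < d -> `|s u - s v| <= w) ->
  tagged_partition 0 t n x xi ->
  (forall i, (i < n)%N -> x i.+1 - x i < d) ->
  `|\sum_(i < n) F (xi i) * (s (x i.+1) - s (x i)) + F 0 * s 0 - P t|
  <= w * F 0.
Proof.
move=> H P0 Ft0 d0 uc part mesh; have [x0 xn tags] := part.
have xle i j := @tagged_partition_le _ _ _ _ _ i j part.
have xge0 i : (i <= n)%N -> 0 <= x i by move=> iN; rewrite -x0 xle.
have xlet i : (i <= n)%N -> x i <= t by move=> iN; rewrite -xn xle// iN leqnn.
(* q m is the tag preceding x m; the left endpoint 0 serves as first tag. *)
pose q m : R := if m is m'.+1 then xi m' else 0.
pose T m := \sum_(i < m) F (xi i) * (s (x i.+1) - s (x i)) + F 0 * s 0.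
have qx m : (m <= n)%N -> 0 <= q m <= x m /\ x m - q m < d.
  case: m => [_|m mn]; first by rewrite /q x0 subrr lexx.
  have /andP[h1 h2] := tags _ mn; split.
    by rewrite /q h2 andbT (le_trans _ h1)// xge0 ?(ltnW mn).
  by apply: le_lt_trans (mesh _ mn); rewrite lerD2l lerN2.
have near_x m r : (m <= n)%N -> q m <= r -> r <= x m -> `|x m - r| < d.
  move=> mn qr rx; have [_] := qx _ mn; apply: le_lt_trans.
  by rewrite ger0_norm ?subr_ge0// lerD2l lerN2.
have main m : (m <= n)%N ->
    `|T m - s (x m) * F (q m) - P (q m)| <= w * (F 0 - F (q m)).
  elim: m => [_|m IH mn].
    by rewrite /T big_ord0 add0r x0 /q P0 subr0 mulrC !subrr normr0 mulr0.
  have {IH} := IH (ltnW mn).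
  have /andP[xim ximS] := tags _ mn.
  have [/andP[qm0 qmx] _] := qx _ (ltnW mn).
  have inc := H (q m) (xi m) (s (x m)) qm0 (le_trans qmx xim)
    (le_trans ximS (xlet _ mn)).
  move=> IH; rewrite [q m.+1]/=.
  have -> : T m.+1 - s (x m.+1) * F (xi m) - P (xi m) =
     (T m - s (x m) * F (q m) - P (q m)) -
     (P (xi m) - P (q m) - s (x m) * (F (q m) - F (xi m))).
    by rewrite /T big_ord_recr/=; ring.
  have -> : w * (F 0 - F (xi m)) =
      w * (F 0 - F (q m)) + w * (F (q m) - F (xi m)) by ring.
  apply: le_trans (ler_normB _ _) _; apply: lerD => //; apply: inc.
  move=> r /andP[qr rxi]; rewrite distrC; apply: uc.
    by rewrite xge0 ?xlet ?(ltnW mn).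
  have [rx|xr] := leP r (x m); first exact: near_x (ltnW mn) qr rx.
  rewrite distrC gtr0_norm ?subr_gt0//; apply: le_lt_trans (mesh _ mn).
  by rewrite lerD2r (le_trans rxi).
(* The last piece, from the last tag to t, has the value s t and F t = 0. *)
have M1 := main _ (leqnn n); have [/andP[qn0 qnx] _] := qx _ (leqnn n).
rewrite xn in M1 qnx; have inc := H (q n) t (s t) qn0 qnx (lexx _).
have -> : \sum_(i < n) F (xi i) * (s (x i.+1) - s (x i)) + F 0 * s 0 - P t =
    (T n - s t * F (q n) - P (q n)) - (P t - P (q n) - s t * (F (q n) - F t)).
  by rewrite Ft0 /T; ring.
have -> : w * F 0 = w * (F 0 - F (q n)) + w * (F (q n) - F t).
  by rewrite Ft0; ring.
apply: le_trans (ler_normB _ _) _; apply: lerD => //; apply: inc.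
move=> r /andP[qr rt]; rewrite distrC; apply: uc.
  by rewrite lexx andbT (le_trans qn0).
by rewrite -xn; apply: near_x; rewrite ?xn.
Qed.

Lemma rs_sum_rl_kernel b s t w d n (x xi : nat -> R) : 0 < b -> continuous s ->
  0 < d -> (forall u v, 0 <= u <= t -> `|u - v| < d -> `|s u - s v| <= w) ->
  tagged_partition 0 t n x xi ->
  (forall i, (i < n)%N -> x i.+1 - x i < d) ->
  `|\sum_(i < n) rl_kernel (b + 1) (t - xi i) * (s (x i.+1) - s (x i))
    + rl_kernel (b + 1) t * s 0 - rl_integral b s t|
  <= w * rl_kernel (b + 1) t.
Proof.
move=> b0 cs d0 uc part mesh.
have := @rs_sum_by_parts s (fun y => rl_kernel (b + 1) (t - y))
  (fun y => \int[mu]_(r in `]0, y]) (rl_kernel b (t - r) * s r)) t w d n x xi.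
rewrite subr0; apply => //.
- by move=> p q k p0 pq qt sw; exact: rl_increment.
- by rewrite set_itv_ge ?bnd_simp ?ltxx// Rintegral_set0.
- by rewrite subrr rl_kernel_le0.
Qed.

End riemann_stieltjes.

(** * The creep function *)
Section creep.
Context {R : realType}.
Implicit Types (a t x : R) (f g : R -> R).

Let one : R -> R := fun=> 1.

Section creep_integral.
Variables (alpha c lam : R).
Hypotheses (a0 : 0 < alpha) (lam0 : 0 < lam).

Local Notation majorant := (majorant alpha lam).
Local Notation neumann_sum := (neumann_sum alpha c lam).
Local Notation neumann_term := (neumann_term alpha c lam).

Let coef n := (- lam) ^+ n * c.

(** The series of the creep function is the series of the strain under the unit
stress. *)
Lemma neumann_term1 n t :
  neumann_term one n t = coef n * rl_kernel (frac_order alpha n + 1) t.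
Proof.
by rewrite /neumann_term rl_integral_cst ?mul1r//; exact: frac_order_gt0.
Qed.

(** Both sides are linear in the partial sum, so the bound for a single kernel
adds up, with a constant that does not depend on N. *)
Lemma rs_sum_neumann s t w d n (x xi : nat -> R) N : continuous s ->
  0 < d -> 0 <= w -> 0 <= t <= 1 ->
  (forall u v, 0 <= u <= t -> `|u - v| < d -> `|s u - s v| <= w) ->
  tagged_partition 0 t n x xi ->
  (forall i, (i < n)%N -> x i.+1 - x i < d) ->
  `|\sum_(i < n) neumann_sum one N (t - xi i) * (s (x i.+1) - s (x i))
    + neumann_sum one N t * s 0 - neumann_sum s N t|
  <= w * (`|c| * series majorant N).
Proof.
move=> cs d0 w0 /andP[t0 t1] uc part mesh; elim: N => [|N IH].
  rewrite !neumann_sum0 mul0r addr0 subr0 seriesEord/= big_ord0 !mulr0.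
  rewrite big1 ?normr0// => i _.
  by rewrite neumann_sum0 mul0r.
rewrite !neumann_sumS neumann_term1.
under eq_bigr do rewrite neumann_sumS neumann_term1 mulrDl -mulrA.
rewrite big_split/= -mulr_sumr.
rewrite [X in `|X|](_ : _ = (\sum_(i < n) neumann_sum one N (t - xi i) *
      (s (x i.+1) - s (x i)) + neumann_sum one N t * s 0 - neumann_sum s N t) +
  coef N * (\sum_(i < n) rl_kernel (frac_order alpha N + 1) (t - xi i) *
      (s (x i.+1) - s (x i)) + rl_kernel (frac_order alpha N + 1) t * s 0
    - rl_integral (frac_order alpha N) s t)); last first.
  have -> : neumann_term s N t =
    coef N * rl_integral (frac_order alpha N) s t by [].
  ring.
apply: le_trans (ler_normD _ _) _.
have -> : w * (`|c| * series majorant N.+1) =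
    w * (`|c| * series majorant N) + w * (`|c| * majorant N).
  by rewrite seriesSr /=; ring.
apply: lerD => //.
rewrite normrM /coef normrM normrX normrN (gtr0_norm lam0) /majorant.
have o0 := frac_order_gt0 a0 N.
have -> : w * (`|c| * (lam ^+ N / Gamma (frac_order alpha N + 1))) =
  lam ^+ N * `|c| * (w * (Gamma (frac_order alpha N + 1))^-1) by ring.
rewrite ler_wpM2l ?mulr_ge0 ?exprn_ge0 ?(ltW lam0)//.
apply: le_trans (rs_sum_rl_kernel o0 cs d0 uc part mesh) _.
by rewrite ler_wpM2l// rl_kernelS_le1.
Qed.

(** The bound of rs_sum_neumann is uniform in N, so it survives the limit for a
fixed partition; the oscillation w is chosen only afterwards. *)
Lemma volterra_creep_integral s e k t : continuous s ->
  (forall u, 0 <= u <= 1 -> (fun N => neumann_sum s N u) @ \oo --> e u) ->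
  (forall u, 0 <= u <= 1 -> (fun N => neumann_sum one N u) @ \oo --> k u) ->
  0 <= t <= 1 -> is_creep_integral k s t (e t).
Proof.
move=> cs he hk t01; have /andP[t0 t1] := t01.
exists (e t - k t * s 0); last by rewrite addrC subrK.
move=> d' d'0.
have cm : cvgn (series majorant) by exact: is_cvg_majorant.
pose K := `|c| * limn (series majorant).
have m0 n : 0 <= majorant n.
  rewrite divr_ge0 ?exprn_ge0 ?(ltW lam0)// ltW// Gamma_gt0//.
  by rewrite addr_gt0// frac_order_gt0.
have smle N : series majorant N <= limn (series majorant).
  apply: nondecreasing_cvgn_le => //; apply/nondecreasing_seqP => n.
  by rewrite seriesSr lerDl.
have K0 : 0 <= K.
  rewrite mulr_ge0//; apply: le_trans (smle 0).
  by rewrite seriesEord/= big_ord0.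
pose w := d' / (K + 1).
have w0 : 0 < w by rewrite divr_gt0// ltr_wpDl.
have [d d0 uc] := unif_continuous_itv 0 t cs w0.
exists d => // n x xi part mesh.
have [x0 xn tags] := part.
have tag01 i : (i < n)%N -> 0 <= t - xi i <= 1.
  move=> iN; have /andP[h1 h2] := tags _ iN.
  have xi0 : 0 <= xi i.
    apply: le_trans h1; rewrite -x0.
    by apply: (tagged_partition_le part) => /=; exact: ltnW.
  have xit : xi i <= t.
    apply: le_trans h2 _; rewrite -xn; apply: (tagged_partition_le part).
    by rewrite iN leqnn.
  by rewrite subr_ge0 xit/= lerBlDr (le_trans t1)// lerDl.
have uc' u v : 0 <= u <= t -> `|u - v| < d -> `|s u - s v| <= w.
  by move=> ut uv; apply: ltW; exact: uc.
have L : (fun N => \sum_(i < n) neumann_sum one N (t - xi i) *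
      (s (x i.+1) - s (x i)) + neumann_sum one N t * s 0 - neumann_sum s N t)
    @ \oo --> \sum_(i < n) k (t - xi i) * (s (x i.+1) - s (x i)) +
      k t * s 0 - e t.
  apply: cvgB; last exact: he.
  apply: cvgD; last by apply: cvgMl; exact: hk.
  apply: cvg_big => [|i _]; first exact: add_continuous.
  by apply: cvgMl; apply: hk; exact: tag01.
have bnd : `|\sum_(i < n) k (t - xi i) * (s (x i.+1) - s (x i)) +
    k t * s 0 - e t| <= w * K.
  apply: ler_cvg_to (cvg_norm L) (cvg_cst (w * K)) _.
  apply: nearW => N.
  apply: le_trans (rs_sum_neumann N cs d0 _ t01 uc' part mesh) _.
    exact: ltW.
  by rewrite ler_wpM2l ?(ltW w0)// ler_wpM2l.
rewrite (_ : _ - _ = \sum_(i < n) k (t - xi i) * (s (x i.+1) - s (x i)) +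
    k t * s 0 - e t); last by ring.
apply: le_lt_trans bnd _.
rewrite /w mulrAC ltr_pdivrMr; last by rewrite ltr_wpDl.
by rewrite ltr_pM2l// ltrDl.
Qed.

End creep_integral.

Lemma cvg_mittag_leffler a z : 0 < a ->
  series (fun n => z ^+ n / Gamma (a * n%:R + 1)) @ \oo --> mittag_leffler a z.
Proof.
move=> a0; have cb := is_cvg_mittag_leffler_series a0 (normr_ge0 z).
have ub n : `|z ^+ n / Gamma (a * n%:R + 1)| <=
    `|z| ^+ n / Gamma (a * n%:R + 1).
  rewrite normrM normrX normfV [`|Gamma _|]gtr0_norm// Gamma_gt0//.
  by rewrite ltr_wpDl// mulr_ge0// ltW.
exact: (series_tail_le ub cb).1.
Qed.

(** The n-th term of the series is a multiple of the term of index n.+1 of the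
Mittag-Leffler series, whose term of index 0 is the 1 that is subtracted. *)
Lemma neumann_one_mittag_leffler (alpha E eta tau t : R) : 0 < alpha ->
  0 < E -> 0 < eta -> tau = eta / E -> 0 <= t ->
  (fun N => neumann_sum alpha (gain alpha eta) (rate alpha E eta) one N t)
    @ \oo --> - (tau / eta) `^ alpha *
      (mittag_leffler alpha (- (t / tau) `^ alpha) - 1).
Proof.
move=> a0 E0 eta0 tauE t0; set z := - (t / tau) `^ alpha.
pose u n := z ^+ n / Gamma (alpha * n%:R + 1).
have u0 : u 0 = 1 by rewrite /u expr0 mulr0 add0r Gamma1 divr1.
rewrite (_ : (fun N => _) =
    (fun N => - (tau / eta) `^ alpha * (series u N.+1 - 1))); last first.
  apply/funext => N; rewrite -u0.
  have /(congr1 (fun h => h N)) <- := seriesS_shift u.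
  rewrite /neumann_sum !seriesEord/= mulr_sumr; apply: eq_bigr => i _.
  rewrite neumann_term1// /u.
  have o0 := frac_order_gt0 a0 i.
  have -> : rl_kernel (frac_order alpha i + 1) t =
      (t `^ alpha) ^+ i.+1 / Gamma (frac_order alpha i + 1).
    have -> : (t `^ alpha) ^+ i.+1 = t `^ frac_order alpha i.
      by rewrite /frac_order powRrM powR_mulrn// powR_ge0.
    move: t0; rewrite le_eqVlt => /predU1P[<-|t0]; last exact: rl_kernelS.
    by rewrite rl_kernel_le0// powR0 ?mul0r// gt_eqF.
  have -> : (tau / eta) `^ alpha = (E `^ alpha)^-1.
    rewrite tauE mulrAC mulfV ?gt_eqF// mul1r.
    by rewrite -[in LHS]powR_inv1 ?(ltW E0)// -powRrM mulN1r powRN.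
  have -> : z = - (t `^ alpha * rate alpha E eta).
    have -> : rate alpha E eta = (E / eta) `^ alpha.
      rewrite /rate powRM ?invr_ge0 ?(ltW E0) ?(ltW eta0)//; congr (_ * _).
      by rewrite -[in RHS]powR_inv1 ?(ltW eta0)// -powRrM mulN1r powRN.
    by rewrite -powRM ?divr_ge0 ?(ltW E0) ?(ltW eta0)// /z tauE invf_div.
  rewrite /gain -/(frac_order alpha i).
  have Ea : E `^ alpha != 0 by rewrite gt_eqF// powR_gt0.
  have ea : eta `^ alpha != 0 by rewrite gt_eqF// powR_gt0.
  have -> : (- (t `^ alpha * rate alpha E eta)) ^+ i.+1 =
      (- rate alpha E eta) ^+ i * (- rate alpha E eta) * (t `^ alpha) ^+ i.+1.
    by rewrite -exprSr -exprMn mulNr mulrC.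
  move: (Gamma _)^-1 => G; move: (_ ^+ i) (_ ^+ i.+1) => p q.
  by rewrite /rate; field; rewrite Ea ea.
apply: cvgMr; apply: cvgB; last exact: cvg_cst.
rewrite (cvg_shiftS (series u)).
exact: cvg_mittag_leffler.
Qed.

Lemma is_creep_integral_eq k1 k2 s1 s2 t v : 0 <= t <= 1 ->
  (forall x, 0 <= x <= 1 -> k1 x = k2 x) ->
  (forall x, 0 <= x <= 1 -> s1 x = s2 x) ->
  is_creep_integral k1 s1 t v -> is_creep_integral k2 s2 t v.
Proof.
move=> t01 hk hs [l hl ->]; have /andP[t0 t1] := t01.
exists l; last by rewrite hk// hs// lexx ler01.
move=> e e0; have [d d0 hd] := hl e e0; exists d => // n x xi part mesh.
have [x0 xn tags] := part.
have x01 i : (i <= n)%N -> 0 <= x i <= 1.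
  move=> iN; rewrite -{1}x0 (tagged_partition_le part)//=.
  apply: le_trans t1; rewrite -xn; apply: (tagged_partition_le part).
  by rewrite iN leqnn.
have := hd n x xi part mesh; congr (`|_ - _| < _); apply: eq_bigr => i _.
rewrite !hs ?x01//; last exact: ltnW.
have /andP[h1 h2] := tags _ (ltn_ord i).
have /andP[h3 _] := x01 _ (ltnW (ltn_ord i)).
have xit : xi i <= t.
  apply: le_trans h2 _; rewrite -xn; apply: (tagged_partition_le part).
  by rewrite ltn_ord leqnn.
rewrite hk// subr_ge0 xit/= lerBlDr (le_trans t1)// lerDl.
exact: le_trans h1.
Qed.

Lemma exists_fine_partition (t d : R) : 0 <= t -> 0 < d ->
  exists n (x : nat -> R), tagged_partition 0 t n x x /\
    forall i, (i < n)%N -> x i.+1 - x i < d.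
Proof.
move=> t0 d0; pose n := (Num.truncn (t / d)).+1.
have n0 : (0 : R) < n%:R by [].
exists n, (fun i => t * (i%:R / n%:R)); split.
  split; first by rewrite mul0r mulr0.
    by rewrite divff ?mulr1// gt_eqF.
  move=> i _; rewrite lexx/= ler_wpM2l// ler_pM2r ?invr_gt0//.
  by rewrite ler_nat.
move=> i _; rewrite -mulrBr -mulrBl -natrB// subSnn mul1r.
rewrite ltr_pdivrMr// mulrC -ltr_pdivrMr//.
exact: truncnS_gt.
Qed.

(** All Riemann-Stieltjes sums against a constant vanish; partitions of small
mesh exist, so the value of the integral is 0 and only the initial jump
remains. *)
Lemma creep_integral_one k t v :
  0 <= t -> is_creep_integral k one t v -> v = k t.
Proof.
move=> t0 [l hl ->]; rewrite mulr1; suff -> : l = 0 by rewrite addr0.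
apply/eqP; rewrite -normr_eq0 eq_le normr_ge0 andbT leNgt; apply/negP => l0.
have [d d0 hd] := hl _ l0.
have [n [x [part mesh]]] := exists_fine_partition t0 d0.
have := hd n x x part mesh; rewrite big1; last first.
  by move=> i _; rewrite subrr mulr0.
by rewrite sub0r normrN ltxx.
Qed.

End creep.

Theorem theorem2 (R : realType) (alpha E eta tau : R) (k : R -> R)
    (halpha : 0 < alpha < 1) (hE : 0 < E) (heta : 0 < eta)
    (htau : tau = eta / E) :
  is_creep_function alpha E eta k <->
  (forall t : R, 0 <= t <= 1 ->
     k t = - (tau / eta) `^ alpha
             * (mittag_leffler alpha (- (t / tau) `^ alpha) - 1)).
Proof.
have /andP[a0 a1] := halpha.
have lam0 : 0 < rate alpha E eta by rewrite divr_gt0 ?powR_gt0.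
pose one : R -> R := fun=> 1.
have c1 : continuous one by move=> x; exact: cvg_cst.
pose S (s : R -> R) N t :=
  neumann_sum alpha (gain alpha eta) (rate alpha E eta) s N t.
have formula (t : R) : 0 <= t <= 1 -> (fun N => S one N t) @ \oo -->
    - (tau / eta) `^ alpha * (mittag_leffler alpha (- (t / tau) `^ alpha) - 1).
  by move=> /andP[t0 _]; exact: neumann_one_mittag_leffler.
have limit (sigma eps : R -> R) (t : R) : {within `[0, 1], continuous sigma} ->
    is_strain alpha E eta sigma eps -> 0 <= t <= 1 ->
    (fun N => S (clamp01 sigma) N t) @ \oo --> eps t.
  move=> cs st t01; rewrite -(clamp01E eps t01).
  apply: volterra_neumann => //.
  - exact: continuous_clamp01.
  - by have [ce _ _] := st; exact: continuous_clamp01.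
  - exact: strain_volterra.
have clamp_one : clamp01 one = one by [].
have c1' : {within `[0, 1], continuous one} by exact: continuous_subspaceT.
split=> [[_ creep] t t01|kE].
  have [[eps st] hcreep] := creep one c1'.
  have /andP[t0 _] := t01.
  rewrite -(creep_integral_one t0 (hcreep eps st t t01)).
  exact: (cvg_unique _ (limit _ _ _ c1' st t01) (formula t t01)).
have strain (s : R -> R) : {within `[0, 1], continuous s} ->
    exists eps, is_strain alpha E eta s eps.
  move=> cs; have cs' := continuous_clamp01 cs.
  have [e ce ve] := volterra_exists (gain alpha eta) a0 lam0 cs'.
  by exists e; exact: volterra_strain.
split.
  have [eps st] := strain one c1'; have [ce _ _] := st.
  apply: subspace_eq_continuous ce => t; rewrite inE/= in_itv/= => t01.
  rewrite /from_subspace kE//.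
  exact: (cvg_unique _ (limit _ _ _ c1' st t01) (formula t t01)).
move=> sigma csigma; split; first exact: strain.
move=> eps st t t01.
apply: (@is_creep_integral_eq _ k k (clamp01 sigma)) => //.
  by move=> x; exact: clamp01E.
apply: (volterra_creep_integral (alpha := alpha)
  (lam := rate alpha E eta)) => //.
- exact: continuous_clamp01.
- by move=> u u01; exact: limit.
- by move=> u u01; rewrite kE//; exact: formula.
Qed.
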